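(* Let $G$ be a group generated by a set $S$. Let $s_1,s_2\in S$ be abelian-primitive elements with $s_1\neq s_2$. Suppose that $G$ satisfies (1) and (2) (which is equivalent to (2')). Then the problem $\mathcal{DP}(G,\mathrm{ab})$ is undecidable. (1) The relations $R_{s_1}$, $R_{s_2}$ and $R_{s_1,s_2}$ are PE-definable in $(G,\mathrm{ab})$. (2) There exists a disjunction $\bigvee_{i=1}^m\Sigma_i(z,x,y_1,\dots,y_n)$ of systems $\Sigma_i$ of equations on variables $z,x,y_1,\dots,y_n$, such that for each $g\in K_{s_1}$ there exists $h_g\in G$ satisfying: the disjunction of systems $\bigvee_{i=1}^m\Sigma_i(g,x,y_1,\dots,y_n)$ PE-defines in $(G,\mathrm{ab})$ the set $$h_g^{-1}\,\{(s_1s_2^{|g|_{s_2}})^t\mid t\in\mathbb{Z}\}\,K_{s_1,s_2}\,h_g\subseteq G.$$ (2') By definition, (2) is equivalent to: a tuple $(x',y_1',\dots,y_n')$ is a solution to some of the systems of equations $\Sigma_i(g,x,y_1,\dots,y_n)$ ($i=1,\dots,m$) if and only if $$x'\in h_g^{-1}\,\{(s_1s_2^{|g|_{s_2}})^t\mid t\in\mathbb{Z}\}\,K_{s_1,s_2}\,h_g.$$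
   Context: $\mathrm{ab}:G\to G^{\mathrm{ab}}=G/G'$ is the abelianisation map. **Abelian-primitive elements and exponent-sums.** An element $s\in S$ is abelian-primitive if $\mathrm{ab}(s)$ generates a subgroup $K\le G^{\mathrm{ab}}$ with $K\cong\mathbb{Z}$ and $G^{\mathrm{ab}}=K\times H$ for some subgroup $H\le G^{\mathrm{ab}}$. Let $\pi:F(S)\to G$ be the natural projection from the free group on $S$, and for $w\in F(S)$ let $|w|_s$ be the sum of the exponents of the letter $s$ in $w$. For abelian-primitive $s\in S$ and $g\in G$, the exponent-sum of $s$ in $g$ is $|g|_s:=|w_g|_s$, where $w_g\in F(S)$ is such that the absolute value of $|w_g|_s$ is minimal among all $w\in F(S)$ with $\pi(w)=g$ (the source asserts that this does not depend on the choice of such $w_g$). Put $K_{s_1}=\{g\in G: |g|_{s_1}=0\}$ and $K_{s_1,s_2}=\{g\in G:|g|_{s_1}=|g|_{s_2}=0\}$. The binary relations are: $R_{s}(g,h)$ holds iff $|g|_{s}=|h|_{s}$ (for $s=s_1,s_2$); $R_{s_1,s_2}(g,h)$ holds iff $|g|_{s_1}=|h|_{s_2}$. **PE-definability.** A system of equations with constraints in $(G,\mathrm{ab})$ is a finite set of equations $w=1$ and constraints $\mathrm{ab}(u)=\mathrm{ab}(v)$, where $w,u,v$ are words in variables, their inverses, and constants from $G$; the systems in (2) are of this kind. A set $D\subseteq G^m$ is PE-definable in $(G,\mathrm{ab})$, PE-defined by a finite disjunction $\bigvee_i\mathcal{E}_i(x_1,\dots,x_m,y_1,\dots,y_k)$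 of such systems, if for all $\mathbf{a}\in G^m$: $\mathbf{a}\in D$ if and only if for some $i$ the system $\mathcal{E}_i(\mathbf{a},\mathbf{y})$ has a solution $\mathbf{y}\in G^k$. A relation is PE-definable if the set of tuples satisfying it is. **The problem $\mathcal{DP}(G,\mathrm{ab})$.** An instance consists of a finite system $\mathcal{E}$ of equations in $G$ (with constants from $G$) on variables $X_1,\dots,X_k$ and a finite system $\Theta$ of equations in the group $G^{\mathrm{ab}}$ on the same variables; the question is whether $\mathcal{E}$ has a solution $(g_1,\dots,g_k)\in G^k$ such that $(\mathrm{ab}(g_1),\dots,\mathrm{ab}(g_k))$ satisfies $\Theta$. It is undecidable if no algorithm answers this for every instance.
   Formalization: It is additionally assumed that for s = s_1, s_2 the exponent-sum |w|_s depends only on π(w) for all w in F(S), not just minimal w; otherwise the claim fails, e.g. for G = S = Z^2, where all exponent-sums vanish and DP is decidable. *)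

(* Defs.v *)
From HB Require Import structures.
From mathcomp Require Import all_boot all_order all_algebra.
From mathcomp Require Import boolp classical_sets.

Set Implicit Arguments.
Unset Strict Implicit.
Unset Printing Implicit Defensive.

Import GRing.Theory Num.Theory.

Local Open Scope classical_set_scope.
Local Open Scope group_scope.

(** * Subgroups of (possibly infinite) groups *)

Section Subgroups.
Context (G : groupType).

Definition subgroup (H : set G) : Prop :=
  H 1 /\ forall x y, H x -> H y -> H (x / y).

Definition gen (A : set G) : set G := smallest subgroup A.

Definition expz (x : G) (t : int) : G :=
  match t with Posz n => x ^+ n | Negz n => x ^- n.+1 end.

Definition isomorphic_to_Z (K : set G) : Prop :=
  exists f : int -> G,
    [/\ forall m n : int, f (m + n)%R = f m * f n, injective f & range f = K].

Definition internal_direct_product (K H : set G) : Prop :=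
  [/\ subgroup K /\ subgroup H,
      forall k h, K k -> H h -> commute k h,
      K `&` H = [set 1] &
      forall x, exists k h, [/\ K k, H h & x = k * h]].

Definition derived : set G := gen [set g | exists x y, g = [~ x, y]].

End Subgroups.

Arguments derived : clear implicits.

(** * The abelianisation *)

Section Abelianisation.
Context (G : groupType).

Lemma derived_subgroup : subgroup (derived G).
Proof.
split; first by move=> M [[M1 _] _].
move=> x y xD yD M [sM cM].
by case: (sM) => _; apply; [exact: xD | exact: yD].
Qed.

Lemma derivedV x : derived G x -> derived G x^-1.
Proof.
by case: derived_subgroup => D1 DB /(DB 1 _ D1); rewrite mul1g.
Qed.

Lemma derivedM x y : derived G x -> derived G y -> derived G (x * y).
Proof.
case: derived_subgroup => D1 DB Dx /derivedV Dy.
by rewrite -[y]invgK; apply: DB.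
Qed.

Lemma derived_comm x y : derived G [~ x, y].
Proof. by move=> M [_]; apply; exists x, y. Qed.

Lemma derivedJ x y : derived G x -> derived G (x ^ y).
Proof.
move=> Dx; have -> : x ^ y = x * [~ x, y] by rewrite /commg mulVKg.
exact: derivedM (derived_comm _ _).
Qed.

Definition ab_rel (x y : G) : bool := `[< derived G (x^-1 * y) >].

Lemma ab_rel_equiv : equiv_class_of ab_rel.
Proof.
split=> [x|x y|y x z].
- by apply/asboolP; rewrite mulVg; case: derived_subgroup.
- by apply/asboolP/asboolP => /derivedV; rewrite invgM invgK.
- move=> /asboolP Dxy /asboolP Dyz; apply/asboolP.
  by have := derivedM Dxy Dyz; rewrite mulgA mulgK.
Qed.

Canonical ab_equiv := EquivRelPack ab_rel_equiv.

Definition abelianisation := {eq_quot ab_rel}%qT.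

HB.instance Definition _ := Choice.on abelianisation.

Definition ab (x : G) : abelianisation := (\pi x)%qT.

Lemma eq_ab x y : (ab x = ab y) <-> derived G (x^-1 * y).
Proof. by split=> [/eqmodP/asboolP | D]; last exact/eqmodP/asboolP. Qed.

Definition ab_repr (u : abelianisation) : G := repr u.

Lemma ab_reprK : cancel ab_repr ab.
Proof. exact: reprK. Qed.

Definition ab_mul (u v : abelianisation) := ab (ab_repr u * ab_repr v).
Definition ab_inv (u : abelianisation) := ab (ab_repr u)^-1.

Lemma ab_mulE x y : ab_mul (ab x) (ab y) = ab (x * y).
Proof.
apply/eq_ab; set x' := ab_repr _; set y' := ab_repr _.
have /eq_ab Dx : ab x' = ab x := ab_reprK _.
have /eq_ab Dy : ab y' = ab y := ab_reprK _.
have -> : (x' * y')^-1 * (x * y) = (x'^-1 * x) ^ y' * (y'^-1 * y).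
  by rewrite /conjg invgM !mulgA mulgK.
exact: derivedM (derivedJ _ Dx) Dy.
Qed.

Lemma ab_invE x : ab_inv (ab x) = ab x^-1.
Proof.
apply/eq_ab; set x' := ab_repr _.
have /eq_ab /derivedV Dx : ab x' = ab x := ab_reprK _.
have -> : (x'^-1)^-1 * x^-1 = (x^-1 * x') ^ x^-1.
  by rewrite /conjg !invgK !mulgA mulgV mul1g.
by apply: derivedJ; rewrite invgM invgK in Dx.
Qed.

Lemma ab_mulA : associative ab_mul.
Proof.
by move=> u v w; rewrite -[u]ab_reprK -[v]ab_reprK -[w]ab_reprK !ab_mulE mulgA.
Qed.

Lemma ab_mul1 : left_id (ab 1) ab_mul.
Proof. by move=> u; rewrite -[u]ab_reprK ab_mulE mul1g. Qed.

Lemma ab_mul1r : right_id (ab 1) ab_mul.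
Proof. by move=> u; rewrite -[u]ab_reprK ab_mulE mulg1. Qed.

Lemma ab_mulV : left_inverse (ab 1) ab_inv ab_mul.
Proof. by move=> u; rewrite -[u]ab_reprK ab_invE ab_mulE mulVg. Qed.

Lemma ab_mulVr : right_inverse (ab 1) ab_inv ab_mul.
Proof. by move=> u; rewrite -[u]ab_reprK ab_invE ab_mulE mulgV. Qed.

HB.instance Definition _ :=
  isGroup.Build abelianisation ab_mulA ab_mul1 ab_mul1r ab_mulV ab_mulVr.

Lemma abM x y : ab (x * y) = ab x * ab y.
Proof. by rewrite -ab_mulE. Qed.

HB.instance Definition _ := isMultiplicative.Build G abelianisation ab abM.

End Abelianisation.

(** * Words *)

(* A letter is a symbol together with a flag, [true] marking its inverse. *)
Definition word (L : Type) := seq (L * bool).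

Definition eval (L : Type) (G : groupType) (f : L -> G) (w : word L) : G :=
  \prod_(a <- w) (if a.2 then (f a.1)^-1 else f a.1).

(* Words in variables from [V] and constants from [C]. *)
Definition term (V C : Type) := word (V + C).

Definition teval (V C : Type) (G : groupType) (nu : V -> G) (c : C -> G)
    (w : term V C) : G :=
  eval (fun l => match l with inl v => nu v | inr k => c k end) w.

(** * Abelian-primitive elements and exponent-sums *)

Section ExponentSums.
Context (G : groupType) (S : set G).

Definition abelian_primitive (s : G) : Prop :=
  let K := gen [set ab s] in
  isomorphic_to_Z K /\ exists H, internal_direct_product K H.

(* The elements of F(S), as freely reduced words. *)
Definition free_words : set (word G) :=
  [set w | (forall a, a \in w -> S a.1) /\
           sorted (fun a b => ~~ ((a.1 == b.1) && (a.2 != b.2))) w].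

Definition proj (w : word G) : G := eval id w.

Definition word_expsum (s : G) (w : word G) : int :=
  (\sum_(a <- w | a.1 == s) (if a.2 then -1 else 1))%R.

Definition minimal_word (s g : G) (w : word G) : Prop :=
  [/\ free_words w, proj w = g &
      forall w', free_words w' -> proj w' = g ->
        (`|word_expsum s w| <= `|word_expsum s w'|)%R].

Definition expsum (s g : G) : int :=
  xget 0%R [set word_expsum s w | w in minimal_word s g].

(* The exponent of [s] in a word depends only on the element of [G] that the
   word represents.  Independence of the choice among minimal words is not
   enough to make [expsum S s] behave as an exponent-sum: for G = S = Z^2 all
   minimal words have exponent 0, so [expsum S s] is identically zero. *)
Definition expsum_well_defined (s : G) : Prop :=
  forall w w', free_words w -> free_words w' -> proj w = proj w' ->
    word_expsum s w = word_expsum s w'.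

Definition expsum_ker (s : G) : set G := [set g | expsum s g = 0%R].

Definition expsum_ker2 (s1 s2 : G) : set G := expsum_ker s1 `&` expsum_ker s2.

(* h^-1 {(s1 s2^{|g|_{s2}})^t | t in Z} K_{s1,s2} h *)
Definition conj_powers (s1 s2 g h : G) : set G :=
  [set x | exists t k, expsum_ker2 s1 s2 k /\
     x = h^-1 * (expz (s1 * expz s2 (expsum s2 g)) t * k) * h].

End ExponentSums.

(** * Systems with abelian constraints and PE-definability *)

Section Systems.
Context (G : groupType).

(* Equations w = 1, and constraints ab(u) = ab(v). *)
Definition system (V : eqType) : eqType :=
  (seq (term V G) * seq (term V G * term V G))%type.

Definition solves (V : eqType) (nu : V -> G) (E : system V) : Prop :=
  (forall w, w \in E.1 -> teval nu id w = 1) /\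
  (forall p, p \in E.2 -> ab (teval nu id p.1) = ab (teval nu id p.2)).

Definition valuation m k (a : m.-tuple G) (y : k.-tuple G)
    (v : 'I_m + 'I_k) : G :=
  match v with inl i => tnth a i | inr j => tnth y j end.

Definition PE_defines m k (Es : seq (system ('I_m + 'I_k)%type))
    (D : set (m.-tuple G)) : Prop :=
  forall a, D a <->
    exists E, E \in Es /\ exists y : k.-tuple G, solves (valuation a y) E.

Definition PE_definable m (D : set (m.-tuple G)) : Prop :=
  exists k (Es : seq (system ('I_m + 'I_k)%type)), PE_defines Es D.

Definition PE_definable_rel (R : G -> G -> Prop) : Prop :=
  PE_definable [set a : 2.-tuple G | R (tnth a ord0) (tnth a ord_max)].

(* Systems in an extra variable z, encoded as [None]; [subst_term g] and
   [subst_system g] replace z by the constant g. *)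
Definition subst_term (V : Type) (g : G) (w : term (option V) G) : term V G :=
  [seq (match a.1 with
        | inl (Some v) => inl v
        | inl None => inr g
        | inr c => inr c
        end, a.2) | a <- w].

Definition subst_system (V : eqType) (g : G) (E : system (option V)) : system V :=
  ([seq subst_term g w | w <- E.1],
   [seq (subst_term g p.1, subst_term g p.2) | p <- E.2]).

End Systems.

(** * Total recursive functions *)

(* Since all functions here are total, minimisation is only applied to
   regular functions; this yields exactly the total computable functions. *)
Inductive recursive : forall n, (n.-tuple nat -> nat) -> Prop :=
| rec_zero : recursive (fun _ : 0.-tuple nat => 0%N)
| rec_succ : recursive (fun v : 1.-tuple nat => (thead v).+1)
| rec_proj n (i : 'I_n) : recursive (fun v : n.-tuple nat => tnth v i)
| rec_comp m n (f : m.-tuple nat -> nat) (g : 'I_m -> n.-tuple nat -> nat) :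
    recursive f -> (forall i, recursive (g i)) ->
    recursive (fun v => f [tuple g i v | i < m])
| rec_prim n (f : n.-tuple nat -> nat) (g : n.+2.-tuple nat -> nat)
    (h : n.+1.-tuple nat -> nat) :
    recursive f -> recursive g ->
    (forall v : n.-tuple nat, h [tuple of 0%N :: v] = f v) ->
    (forall k (v : n.-tuple nat), h [tuple of k.+1 :: v] =
       g [tuple of k :: h [tuple of k :: v] :: v]) ->
    recursive h
| rec_mu n (f : n.+1.-tuple nat -> nat) (g : n.-tuple nat -> nat) :
    recursive f ->
    (forall v : n.-tuple nat, f [tuple of g v :: v] = 0%N /\
       forall k, (k < g v)%N -> f [tuple of k :: v] <> 0%N) ->
    recursive g.

(* An algorithm deciding [P] works on the codes [pickle x], the effective
   coding of nested sequences, pairs and sums provided by the library. *)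
Definition decidable_problem (T : countType) (P : T -> Prop) : Prop :=
  exists f : 1.-tuple nat -> nat, recursive f /\
    forall x, (P x -> f [tuple pickle x] = 1%N) /\
              (~ P x -> f [tuple pickle x] = 0%N).

(** * The problem DP(G, ab) *)

(* An instance (E, Theta) over [r] names of constants; every word w stands for
   the equation w = 1.  Variables are named by natural numbers, only finitely
   many of which occur in a given instance. *)
Definition DP_instance (r : nat) : countType :=
  (seq (term nat 'I_r) * seq (term nat 'I_r))%type.

Definition DP_solvable (G : groupType) r (c : r.-tuple G) (I : DP_instance r) :
    Prop :=
  exists nu : nat -> G,
    (forall w, w \in I.1 -> teval nu (tnth c) w = 1) /\
    (forall w, w \in I.2 ->
       teval (fun v => ab (nu v)) (fun i => ab (tnth c i)) w = 1).

(* Algorithms take finite inputs, so constants are given as words over a finite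
   list [c] of elements of G, and constants of the abelianisation as images of
   such words.  For finitely generated G it is equivalent to consider only one
   [c], namely any finite generating tuple. *)
Definition DP_decidable (G : groupType) : Prop :=
  forall r (c : r.-tuple G), decidable_problem (DP_solvable c).

Definition DP_undecidable (G : groupType) : Prop := ~ DP_decidable G.

(* Main.v *)
Require Import Defs.
From mathcomp Require Import all_boot all_order all_algebra.
From mathcomp Require Import boolp classical_sets.
From mathcomp Require Import zify.

(** The exponent-sums [e1] and [e2] with respect to [s1] and [s2] are
    homomorphisms onto the integers, and modulo [K_{s1,s2}] an element [x] is
    determined by [(e1 x, e2 x)].  Hence for [g] in the kernel of [e1] the set in
    condition (2) is [{x | e2 x = e1 x * e2 g}], whatever the conjugator [h_g] is.
    Representing an integer by any element with that value of [e1], equality,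
    addition and multiplication become PE-definable, so every Diophantine set of
    integers is a finite union of projections of solution sets of instances.

    By the theorem of Davis, Putnam, Robinson and Matiyasevich, the set defined
    by a recursive condition is Diophantine.  Because PE-definitions involve
    disjunctions, a Diophantine set yields a finite list of instances rather
    than one, and the diagonal argument runs over lists: given a decision
    function [f], consider the triples [(u, v, w)] such that [f] rejects each of
    the [w] instances coded by Goedel's beta function at [(u, v)], after equations
    fixing three variables to [s1^u], [s1^v], [s1^w] have been added to it.  This
    set comes from a list of instances, and a triple coding that list belongs to
    the set if and only if it does not. *)

Set Implicit Arguments.
Unset Strict Implicit.
Unset Printing Implicit Defensive.

Import GRing.Theory Num.Theory Order.TTheory.

(** * Lucas sequences *)

Section Lucas.
Local Open Scope ring_scope.
Local Open Scope int_scope.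

(** Multiplication comes from condition (2), where one factor and the product are exponents of [s2];
    the relation [R_{s1,s2}] moves values between the two exponents, and [R_{s1}] plays the role of
    equality because many group elements represent the same integer. The order of the integers is
    not given, so nonnegativity is expressed by sums of squares before results on natural numbers
    can be transferred. The diagonal set is built from [f] itself rather than from a universal
    Diophantine equation. What must then be Diophantine is the map from the triple to the codes of
    the extended instances, and this is why the codes of the words fixing a variable to a power of
    [s1] are computed in closed form. The PE-definitions mention finitely many constants; these form
    one tuple, and decidability is refuted for that tuple. *)

Fixpoint lucas_pair (b : int) (n : nat) : int * int :=
  if n is n'.+1 then let p := lucas_pair b n' in (p.2, b * p.2 - p.1) else (0, 1).

(** The Lucas sequence with parameters (b, 1), written U_n below. For b at least 2, pairs of
    neighbours are the solutions of x^2 - bxy + y^2 = 1 with 0 <= x <= y, and b = 2 gives U_n = n;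
    these two facts tie values to indices. *)
Definition lucas b n := (lucas_pair b n).1.

Lemma lucasSS b n : lucas b n.+2 = b * lucas b n.+1 - lucas b n.
Proof. by []. Qed.

Lemma lucas0 b : lucas b 0 = 0. Proof. by []. Qed.
Lemma lucas1 b : lucas b 1 = 1. Proof. by []. Qed.

Lemma lucas2n n : lucas 2 n = n%:Z.
Proof.
suff: lucas 2 n = n%:Z /\ lucas 2 n.+1 = n.+1%:Z by case.
by elim: n => [|n [IH1 IH2]] //; split=> //; rewrite lucasSS IH1 IH2; lia.
Qed.

Lemma lucas_pell b n :
  lucas b n * lucas b n + lucas b n.+1 * lucas b n.+1
    = b * lucas b n * lucas b n.+1 + 1.
Proof.
elim: n => [|n IH]; first by rewrite lucas0 lucas1; lia.
rewrite lucasSS; move: IH; set x := lucas b n; set y := lucas b n.+1 => IH.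
suff -> : y * y + (b * y - x) * (b * y - x) = x * x + y * y - b * x * y + b * y * (b * y - x).
  by rewrite IH; lia.
lia.
Qed.

(** The upper left entry of a product of powers of the companion matrix of the recurrence, whose
    n-th power has first row (U_{n+1}, -U_n) and first column (U_{n+1}, U_n). *)
Lemma lucasD1 b m n :
  lucas b (m + n).+1 = lucas b m.+1 * lucas b n.+1 - lucas b m * lucas b n.
Proof.
elim: m n => [|m IH] n; first by rewrite lucas0 lucas1 add0n; lia.
by rewrite addSnnS IH !lucasSS; lia.
Qed.

Lemma lucasD b m n :
  lucas b (m + n) = lucas b m * lucas b n.+1 + lucas b m.+1 * lucas b n
                    - b * lucas b m * lucas b n.
Proof.
case: n => [|n]; first by rewrite addn0 lucas0 lucas1; lia.
by rewrite addnS lucasD1 lucasSS; lia.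
Qed.

Lemma lucas_coprime b n d :
  (d %| lucas b n)%Z -> (d %| lucas b n.+1)%Z -> (d %| 1)%Z.
Proof.
move=> dx dy.
have -> : 1 = lucas b n * (lucas b n - b * lucas b n.+1) + lucas b n.+1 * lucas b n.+1.
  by have := lucas_pell b n; lia.
by rewrite rpredD // dvdz_mulr.
Qed.

Lemma coprimez_lucas b n : coprimez (lucas b n) (lucas b n.+1).
Proof.
rewrite /coprimez; have := @lucas_coprime b n _ (dvdz_gcdl _ _) (dvdz_gcdr _ _).
by rewrite dvdz1 /gcdz absz_nat eqz_nat.
Qed.

Lemma lucas_mod b b' v n : (v %| b - b')%Z -> (v %| lucas b n - lucas b' n)%Z.
Proof.
move=> vb; suff: (v %| lucas b n - lucas b' n)%Z /\ (v %| lucas b n.+1 - lucas b' n.+1)%Z by case.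
elim: n => [|n [IH1 IH2]]; first by rewrite !lucas0 !lucas1 !subrr dvdz0.
split=> //; rewrite !lucasSS.
have -> : b * lucas b n.+1 - lucas b n - (b' * lucas b' n.+1 - lucas b' n)
  = (b - b') * lucas b n.+1 + b' * (lucas b n.+1 - lucas b' n.+1) - (lucas b n - lucas b' n).
  by lia.
by rewrite rpredB // rpredD //; [exact: dvdz_mulr | exact: dvdz_mull].
Qed.

Lemma lucas_dvdM b k l : (lucas b k %| lucas b (k * l))%Z.
Proof.
elim: l => [|l IH]; first by rewrite muln0 lucas0 dvdz0.
rewrite mulnS addnC lucasD rpredB ?rpredD //.
- exact: dvdz_mulr.
- exact: dvdz_mull.
- exact: dvdz_mull.
Qed.

(** First-order expansion modulo U_k^2 of an l-th power. The extra factor U_{k+1} in the first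
    congruence avoids the exponent l - 1 and can be cancelled because neighbours are coprime. *)
Lemma lucas_pow b k l :
  (lucas b k ^+ 2 %| lucas b (k * l) * lucas b k.+1
                    - l%:Z * lucas b k * lucas b k.+1 ^+ l)%Z /\
  (lucas b k ^+ 2 %| lucas b (k * l).+1 - lucas b k.+1 ^+ l)%Z.
Proof.
elim: l => [|l [IH1 IH2]].
  rewrite muln0 lucas0 lucas1 expr0 subrr dvdz0; split=> //.
  have -> : 0 * lucas b k.+1 - 0%:Z * lucas b k * 1 = 0 by lia.
  exact: dvdz0.
rewrite mulnS addnC.
have /dvdzP [q Hq] := lucas_dvdM b k l.
case/dvdzP: IH1 => q1 Hq1; case/dvdzP: IH2 => q2 Hq2.
split.
  rewrite lucasD exprS; have -> : l.+1%:Z = l%:Z + 1 by lia.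
  set x := lucas b k in Hq Hq1 Hq2 *; set y := lucas b k.+1 in Hq Hq1 Hq2 *.
  set X := lucas b (k * l) in Hq Hq1 Hq2 *; set Y := lucas b (k * l).+1 in Hq Hq1 Hq2 *.
  have -> : (X * y + Y * x - b * X * x) * y - (l%:Z + 1) * x * (y * y ^+ l)
     = (X * y - l%:Z * x * y ^+ l) * y + x * y * (Y - y ^+ l) - b * X * x * y by lia.
  rewrite Hq1 Hq2 Hq; apply/dvdzP; exists (q1 * y + q2 * x * y - b * q * y); lia.
rewrite lucasD1 exprS.
set x := lucas b k in Hq Hq1 Hq2 *; set y := lucas b k.+1 in Hq Hq1 Hq2 *.
set X := lucas b (k * l) in Hq Hq1 Hq2 *; set Y := lucas b (k * l).+1 in Hq Hq1 Hq2 *.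
have -> : Y * y - X * x - y * y ^+ l = (Y - y ^+ l) * y - X * x by lia.
rewrite Hq2 Hq; apply/dvdzP; exists (q2 * y - q); lia.
Qed.

(* [p ^ n] satisfies the recurrence of [lucas b] modulo the value at [p] of
   its characteristic polynomial. *)
Lemma lucas_exp b p n :
  (p * b - p * p - 1 %| p ^+ n + b * lucas b n - (lucas b n.+1 + p * lucas b n))%Z.
Proof.
suff: forall m, (p * b - p * p - 1 %| p ^+ m + b * lucas b m - (lucas b m.+1 + p * lucas b m))%Z
  /\ (p * b - p * p - 1 %| p ^+ m.+1 + b * lucas b m.+1 - (lucas b m.+2 + p * lucas b m.+1))%Z.
  by move=> /(_ n) [].
elim=> [|m [/dvdzP [q1 H1] /dvdzP [q2 H2]]].
  rewrite lucasSS lucas0 lucas1 expr0 expr1; split; apply/dvdzP; exists 0; lia.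
split; first by apply/dvdzP; exists q2.
apply/dvdzP; exists (b * q2 - q1 - p ^+ m).
move: H1 H2; rewrite !(lucasSS b m.+1) (lucasSS b m).
set x := lucas b m; set y := lucas b m.+1; rewrite !exprS; set P := p ^+ m => H1 H2.
have -> : (b * q2 - q1 - P) * (p * b - p * p - 1) =
  b * (q2 * (p * b - p * p - 1)) - q1 * (p * b - p * p - 1) - P * (p * b - p * p - 1) by lia.
by rewrite -H1 -H2; lia.
Qed.

(** * Growth, solutions of the Pell equation and divisibility *)

Section Monotone.
Variable b : int.
Hypothesis b_ge2 : 2 <= b.

Lemma lucas_lt n : 0 <= lucas b n /\ lucas b n < lucas b n.+1.
Proof.
elim: n => [|n [IH1 IH2]]; first by rewrite lucas0 lucas1.
by rewrite lucasSS; split; nia.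
Qed.

Lemma lucas_ge0 n : 0 <= lucas b n. Proof. by case: (lucas_lt n). Qed.

Lemma lucas_ltS n : lucas b n < lucas b n.+1. Proof. by case: (lucas_lt n). Qed.

Lemma lucas_le m n : (m <= n)%N -> lucas b m <= lucas b n.
Proof.
move=> /subnK <-; elim: (n - m)%N => [|k IH] //.
by rewrite addSn; have := lucas_ltS (k + m); lia.
Qed.

Lemma lucas_mono m n : (m < n)%N -> lucas b m < lucas b n.
Proof. by move=> /lucas_le; have := lucas_ltS m; lia. Qed.

Lemma lucas_geid n : n%:Z <= lucas b n.
Proof. by elim: n => [|n IH] //; have := lucas_ltS n; lia. Qed.

Lemma lucas_ge_exp n : (b - 1) ^+ n <= lucas b n.+1.
Proof.
elim: n => [|n IH]; first by rewrite expr0.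
by rewrite exprS lucasSS; have := lucas_ltS n; nia.
Qed.

(** Descent from (x, y) to (bx - y, x): the new entry is the other root of the equation seen as a
    quadratic in y, and y(bx - y) = x^2 - 1 keeps it between 0 and x when x > 0. *)
Lemma lucas_pell_inv (x y : int) : 0 <= x -> x <= y ->
  x * x + y * y = b * x * y + 1 -> exists n, x = lucas b n /\ y = lucas b n.+1.
Proof.
move=> x0; have [N] : exists N : nat, x <= N%:Z by exists `|x|%N; lia.
elim: N x y x0 => [|N IH] x y x0 xN xy E.
  exists 0%N; rewrite lucas0 lucas1; nia.
have [x_eq0|x_gt0] : x = 0 \/ 0 < x by lia.
  by exists 0%N; rewrite lucas0 lucas1; nia.
have Hprod : y * (b * x - y) = x * x - 1 by lia.
have y'0 : 0 <= b * x - y by nia.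
have y'x : b * x - y < x by nia.
have [||||n [E1 E2]] := IH (b * x - y) x; try lia.
by exists n.+1; rewrite lucasSS -E1 -E2; split=> //; lia.
Qed.

(** With m = qk + r, U_m is congruent to U_{qk+1} U_r modulo U_k. The first factor is a unit, so U_k
    divides U_r, and U_r < U_k forces r = 0. *)
Lemma lucas_dvd_index k m : (0 < k)%N -> (lucas b k %| lucas b m)%Z -> (k %| m)%N.
Proof.
move=> k0 Hd; rewrite /dvdn; move: Hd; rewrite {1}(divn_eq m k).
set q := (m %/ k)%N; set r := (m %% k)%N => Hd.
have rk : (r < k)%N by rewrite ltn_mod.
have Hq : (lucas b k %| lucas b (q * k))%Z by rewrite mulnC; exact: lucas_dvdM.
have H1 : (lucas b k %| lucas b (q * k).+1 * lucas b r)%Z.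
  have -> : lucas b (q * k).+1 * lucas b r = lucas b (q * k + r)
     - (lucas b r.+1 - b * lucas b r) * lucas b (q * k) by rewrite lucasD; lia.
  by rewrite rpredB // dvdz_mull.
have H2 : coprimez (lucas b k) (lucas b (q * k).+1).
  rewrite /coprimez; have := @lucas_coprime b (q * k) (gcdz (lucas b k) (lucas b (q * k).+1)).
  move=> /(_ (dvdz_trans (dvdz_gcdl _ _) Hq) (dvdz_gcdr _ _)); by rewrite dvdz1 /gcdz absz_nat eqz_nat.
rewrite Gauss_dvdzr // in H1.
case: (posnP r) => [/eqP//|r0].
have := lucas_mono rk; have := lucas_mono r0; rewrite lucas0 => A B.
have /dvdzP [z Hz] := H1; have [z0|z1] : z <= 0 \/ 1 <= z by lia.
  by nia.
by nia.
Qed.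

(** By [lucas_dvd_index] m = kl, and [lucas_pow] then leaves that U_k divides l U_{k+1}^l. A
    divisibility between values becomes one of an index by a value. *)
Lemma lucas_sqr_dvd k m : (0 < k)%N ->
  (lucas b k * lucas b k %| lucas b m)%Z -> (lucas b k %| m%:Z)%Z.
Proof.
move=> k0 Hd.
have /(lucas_dvd_index k0) /dvdnP [l Hl] : (lucas b k %| lucas b m)%Z.
  exact: dvdz_trans (dvdz_mulr _ (dvdzz _)) Hd.
have [H1 _] := lucas_pow b k l.
move: Hd; rewrite Hl mulnC => Hd.
have H2 : (lucas b k ^+ 2 %| l%:Z * lucas b k * lucas b k.+1 ^+ l)%Z.
  have -> : l%:Z * lucas b k * lucas b k.+1 ^+ l = lucas b (k * l) * lucas b k.+1
     - (lucas b (k * l) * lucas b k.+1 - l%:Z * lucas b k * lucas b k.+1 ^+ l) by lia.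
  by rewrite rpredB // dvdz_mulr // expr2.
have u0 : lucas b k != 0 by have := lucas_geid k; lia.
have {}H2 : (lucas b k %| l%:Z * lucas b k.+1 ^+ l)%Z.
  by rewrite -(dvdz_mul2l u0); move: H2; rewrite expr2; congr (_ %| _)%Z; lia.
rewrite Gauss_dvdzl in H2; last exact/coprimezXr/coprimez_lucas.
by rewrite PoszM dvdz_mull.
Qed.

Lemma lucas_sqr_dvdM k : (lucas b k * lucas b k %| lucas b (k * `|lucas b k|))%Z.
Proof.
have [H1 _] := lucas_pow b k `|lucas b k|%N.
rewrite gez0_abs ?lucas_ge0 // in H1.
have H2 : (lucas b k ^+ 2 %| lucas b (k * `|lucas b k|) * lucas b k.+1)%Z.
  rewrite -(subrK (lucas b k * lucas b k * lucas b k.+1 ^+ `|lucas b k|)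
    (lucas b (k * `|lucas b k|) * lucas b k.+1)).
  by rewrite rpredD // expr2 dvdz_mulr.
rewrite Gauss_dvdzl in H2; first by rewrite -expr2.
exact/coprimezXl/coprimez_lucas.
Qed.

(** * Residues modulo U_{m+1} - U_{m-1} *)

Section Period.
Variable m : nat.
Hypothesis m_gt0 : (0 < m)%N.
Let v := lucas b m.+1 - lucas b m.-1.

(** Both sides satisfy the recurrence in j and agree at j = 0 and j = 1. *)
Lemma lucas_reflect j : (j <= m)%N ->
  lucas b (m + j) - lucas b (m - j) = lucas b j * v.
Proof.
have H2 i : (i.+1 < m)%N -> lucas b (m - i.+2) = b * lucas b (m - i.+1) - lucas b (m - i).
  move=> im; have -> : (m - i = (m - i.+2).+2)%N by lia.
  have -> : (m - i.+1 = (m - i.+2).+1)%N by lia.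
  by rewrite lucasSS; lia.
suff : ((j <= m)%N -> lucas b (m + j) - lucas b (m - j) = lucas b j * v) /\
  ((j < m)%N -> lucas b (m + j.+1) - lucas b (m - j.+1) = lucas b j.+1 * v) by case.
elim: j => [|j [IH1 IH2]].
  by rewrite lucas0 lucas1 addn0 subn0 addn1 subn1 /v; split; lia.
split=> [|jm]; first exact: IH2.
rewrite H2 // !addnS !lucasSS -addnS.
have := IH1 (ltnW (ltnW jm)); have := IH2 (ltnW jm).
set A := lucas b (m + j.+1); set B := lucas b (m + j).
set C := lucas b (m - j.+1); set D := lucas b (m - j) => e1 e2.
have -> : b * A - B - (b * C - D) = b * (A - C) - (B - D) by lia.
by rewrite e1 e2; lia.
Qed.

(** Reflection at j = m and j = m - 1 gives U_{2m} = 0 and U_{2m-1} = 1 modulo v, hence U_{2m+1} =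
    -1: after 2m steps the negated sequence starts. *)
Lemma lucas_antiperiod n : (v %| lucas b (2 * m + n) + lucas b n)%Z.
Proof.
suff : (v %| lucas b (2 * m + n) + lucas b n)%Z /\
       (v %| lucas b (2 * m + n.+1) + lucas b n.+1)%Z by case.
elim: n => [|n [/dvdzP [q1 H1] /dvdzP [q2 H2]]].
  have := lucas_reflect (leqnn m); have := @lucas_reflect m.-1 (leq_pred m).
  have -> : (m - m.-1 = 1)%N by lia.
  have -> : (m + m.-1 = (2 * m).-1)%N by lia.
  have -> : (m + m = 2 * m)%N by lia.
  rewrite subnn addn0 addn1 lucas0 lucas1 => E1 E2.
  have := lucasSS b (2 * m).-1; rewrite prednK ?muln_gt0 // => E3.
  split; apply/dvdzP; first by exists (lucas b m); lia.
  exists (b * lucas b m - lucas b m.-1); rewrite E3.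
  have -> : lucas b (2 * m) = lucas b m * v by lia.
  have -> : lucas b (2 * m).-1 = lucas b m.-1 * v + 1 by lia.
  by lia.
split; first by apply/dvdzP; exists q2.
apply/dvdzP; exists (b * q2 - q1).
move: H2; rewrite !addnS !lucasSS => H2.
transitivity (b * (q2 * v) - q1 * v); last by lia.
by rewrite -H1 -H2; lia.
Qed.

(** Division by 2m replaces n by its remainder r at the cost of a sign; if r > m, it is reflected to
    2m - r. The signs in the two congruences are independent. *)
Lemma lucas_residue n : exists j, [/\ (j <= m)%N,
  (v %| lucas b n - lucas b j)%Z \/ (v %| lucas b n + lucas b j)%Z &
  (m%:Z %| n%:Z - j%:Z)%Z \/ (m%:Z %| n%:Z + j%:Z)%Z].
Proof.
have shift q r : (v %| lucas b (q * (2 * m) + r) - lucas b r)%Z \/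
                 (v %| lucas b (q * (2 * m) + r) + lucas b r)%Z.
  elim: q => [|q IH]; first by left; rewrite mul0n add0n subrr dvdz0.
  have /dvdzP [z Hz] := lucas_antiperiod (q * (2 * m) + r).
  rewrite mulSn -addnA; case: IH => /dvdzP [z' Hz']; [right | left];
    apply/dvdzP; [exists (z - z') | exists (z - z')]; lia.
have m2 : (0 < 2 * m)%N by rewrite muln_gt0.
have := shift (n %/ (2 * m))%N (n %% (2 * m))%N; rewrite -divn_eq.
have En := divn_eq n (2 * m); have rlt := ltn_pmod n m2.
move: (n %/ (2 * m))%N (n %% (2 * m))%N En rlt => q r En rlt H.
have [rm|mr] := leqP r m.
  exists r; split=> //; left; apply/dvdzP; exists (2 * q%:Z); lia.
exists (2 * m - r)%N; split; first by lia.
  have /lucas_reflect E : (r - m <= m)%N by lia.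
  have Em : (m + (r - m) = r)%N by lia.
  have Em' : (m - (r - m) = 2 * m - r)%N by lia.
  rewrite Em Em' in E.
  case: H => /dvdzP [z Hz]; [left | right]; apply/dvdzP.
    by exists (z + lucas b (r - m)); lia.
  by exists (z - lucas b (r - m)); lia.
right; apply/dvdzP; exists (2 * q%:Z + 2); nia.
Qed.
End Period.
End Monotone.
End Lucas.

(** * A Diophantine definition of Lucas sequences *)

Section LucasDiophantine.
Local Open Scope nat_scope.

Lemma dvdz_small (d x : int) : (d %| x)%Z -> (`|x| < d)%R -> x = 0%R.
Proof.
case/dvdzP => q ->; have [?|[->|?]] : (q <= -1)%R \/ (q = 0)%R \/ (q >= 1)%R by lia.
- nia.
- by rewrite mul0r.
- nia.
Qed.

Lemma dvdz_addnP (v x a : nat) : (a <= x)%N ->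
  (Posz v %| (Posz x - Posz a)%R)%Z -> exists z, x = (a + v * z)%N.
Proof.
by move=> ax; rewrite subzn // => /dvdnP [z Hz]; exists z; lia.
Qed.

Definition lucasn (b n : nat) : nat := `|lucas b n|%N.

Lemma lucasnE b n : 1 < b -> Posz (lucasn b n) = lucas b n.
Proof. by move=> b1; rewrite gez0_abs // lucas_ge0 //; lia. Qed.

(** Modulo 2 only the parity of b matters: b = 2 gives U_n = n, and b = 1 gives a sequence of period
    6 with U_1 = 1. Oddness of [u] will make it coprime to [v]. *)
Lemma lucasn_odd b k : odd (lucasn b (6 * k).+1).
Proof.
have L1 : lucas 1 (6 * k) = 0%R /\ lucas 1 (6 * k).+1 = 1%R.
  elim: k => [|k [IH1 IH2]] //.
  have -> : 6 * k.+1 = (6 * k).+4.+2 by lia.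
  by rewrite !lucasSS IH1 IH2; lia.
have [b' [Eb|Eb]] : exists b', b = b' * 2 \/ b = b' * 2 + 1.
- by exists b./2; lia.
- have /dvdzP [z Hz] : (2 %| (lucas b (6 * k).+1 - lucas 2 (6 * k).+1)%R)%Z.
    by apply: lucas_mod; apply/dvdzP; exists (Posz b' - 1)%R; lia.
  by move: Hz; rewrite lucas2n /lucasn; lia.
have /dvdzP [z Hz] : (2 %| (lucas b (6 * k).+1 - lucas 1 (6 * k).+1)%R)%Z.
  by apply: lucas_mod; apply/dvdzP; exists (Posz b'); lia.
by move: Hz; rewrite (proj2 L1) /lucasn; lia.
Qed.

(* Matiyasevich's system for [a = lucas b c].  Here [u = lucas b k],
   [s = lucas b m] and [r = lucas b (m - 1)]; [u * u] dividing [s] makes [u]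
   divide [m], and [v = lucas b (m + 1) - lucas b (m - 1)] is a modulus for which
   [lucas b] is antiperiodic with antiperiod [2 * m].  Since [w] is congruent to
   [b] modulo [v] and to [2] modulo [u], the number [x = lucas w n] is congruent
   to [lucas b n] modulo [v] and to [n] modulo [u]. *)
Definition lucas_system (b a c r s t u v w x y z z1 z2 z3 z4 : nat) : Prop :=
  [/\ u * u + t * t = b * u * t + 1, s * s + r * r = b * s * r + 1,
      r < s, s = u * u * z & v + 2 * r = b * s] /\
  [/\ w = b + v * z1, w = 2 + u * z2, x * x + y * y = w * x * y + 1,
      x = a + v * z3 & x = c + u * z4] /\
  [/\ 2 * a < u, 2 * a < v & 2 * c < u].

Lemma pell_lucas b x y : 1 < b -> x * x + y * y = b * x * y + 1 ->
  exists n, Posz x = lucas b n.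
Proof.
move=> b1 E.
have H (x' y' : nat) : x' <= y' -> x' * x' + y' * y' = b * x' * y' + 1 ->
    exists n, Posz x' = lucas b n /\ Posz y' = lucas b n.+1.
  by move=> le_xy E'; apply: lucas_pell_inv; lia.
have [le_xy|lt_yx] := leqP x y.
  by have [n []] := H x y le_xy E; exists n.
have [|n [_ ?]] := H y x (ltnW lt_yx); first by lia.
by exists n.+1.
Qed.

(** Let j be the folded index of n. Modulo v, a = x = U_n is U_j up to sign; modulo u, c = x = n is
    j up to sign. As a and U_j lie below v/2, and c and j below u/2, this forces a = U_j and c =
    j. *)
Lemma lucas_system_sound b a c r s t u v w x y z z1 z2 z3 z4 : 3 < b ->
  lucas_system b a c r s t u v w x y z z1 z2 z3 z4 -> Posz a = lucas b c.
Proof.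
move=> b3 [[Eut Esr rs Es Ev] [[Ew1 Ew2 Exy Ex1 Ex2] [au av cu]]].
have b1 : 1 < b by lia.
have b2 : (2 <= Posz b)%R by lia.
have w1 : 1 < w by lia.
have [k Ek] := pell_lucas b1 Eut.
have k0 : 0 < k by case: (posnP k) => // k0; move: Ek; rewrite k0 lucas0; lia.
have [m [Er Esm]] : exists m, Posz r = lucas b m /\ Posz s = lucas b m.+1.
  by apply: lucas_pell_inv => //; lia.
have [n En] := pell_lucas w1 Exy.
have Hum : (Posz u %| Posz m.+1)%Z.
  rewrite Ek; apply: lucas_sqr_dvd => //; rewrite -Ek -Esm.
  by apply/dvdzP; exists (Posz z); lia.
have Evm : Posz v = (lucas b m.+2 - lucas b m)%R.
  by rewrite lucasSS -Er -Esm; lia.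
have [j [jm Hv Hm]] := lucas_residue b2 (ltn0Sn m) n.
rewrite -Evm in Hv.
have Hxv : (Posz v %| (Posz x - lucas b n)%R)%Z.
  by rewrite En; apply: lucas_mod; apply/dvdzP; exists (Posz z1); clear -Ew1; lia.
have Hxu : (Posz u %| (Posz x - Posz n)%R)%Z.
  by rewrite En -(lucas2n n); apply: lucas_mod; apply/dvdzP; exists (Posz z2); clear -Ew2; lia.
have [j0 js] : (0 <= lucas b j /\ lucas b j <= Posz s)%R.
  by rewrite lucas_ge0 // Esm; split=> //; exact: lucas_le.
(* Here b > 3 gives v = bs - 2r >= 4s - 2r > 2s. *)
have lt_sv : (2 * Posz s < Posz v)%R.
  have H4 : 4 * s <= b * s by rewrite leq_mul2r b3 orbT.
  clear -H4 rs Ev; lia.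
have Ea : Posz a = lucas b j.
  case/dvdzP: Hxv => q1 H1; case: Hv => /dvdzP [q2 H2].
    suff /dvdz_small : (Posz v %| (Posz a - lucas b j)%R)%Z by clear -j0 js lt_sv av; lia.
    by apply/dvdzP; exists (q1 + q2 - Posz z3)%R; clear -H1 H2 Ex1; lia.
  suff /dvdz_small : (Posz v %| (Posz a + lucas b j)%R)%Z by clear -j0 js lt_sv av; lia.
  by apply/dvdzP; exists (q1 + q2 - Posz z3)%R; clear -H1 H2 Ex1; lia.
have ja : (Posz j <= Posz a)%R by rewrite Ea; exact: lucas_geid.
have Hmu : (Posz u %| (Posz n - Posz j)%R)%Z \/ (Posz u %| (Posz n + Posz j)%R)%Z.
  by case: Hm => Hm; [left | right]; exact: dvdz_trans Hum Hm.
suff -> : c = j by [].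
case/dvdzP: Hxu => q1 H1; case: Hmu => /dvdzP [q2 H2].
  suff /dvdz_small : (Posz u %| (Posz c - Posz j)%R)%Z by clear -ja au cu; lia.
  by apply/dvdzP; exists (q1 + q2 - Posz z4)%R; clear -H1 H2 Ex2; lia.
suff /dvdz_small : (Posz u %| (Posz c + Posz j)%R)%Z by clear -ja au cu; lia.
by apply/dvdzP; exists (q1 + q2 - Posz z4)%R; clear -H1 H2 Ex2; lia.
Qed.

Lemma lucasn_pell b n : 1 < b ->
  lucasn b n * lucasn b n + lucasn b n.+1 * lucasn b n.+1
    = b * lucasn b n * lucasn b n.+1 + 1.
Proof.
move=> b1; have := lucas_pell b n; rewrite -!lucasnE //; lia.
Qed.

Lemma lucas_le_param b b' n : 1 < b -> b <= b' -> (lucas b n <= lucas b' n)%R.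
Proof.
move=> b1 bb'; have [b2 b2'] : (2 <= Posz b)%R /\ (2 <= Posz b')%R by lia.
suff: (lucas b n <= lucas b' n /\ lucas b n.+1 - lucas b n <= lucas b' n.+1 - lucas b' n)%R by case.
elim: n => [|n [IH1 IH2]]; first by rewrite !lucas0 !lucas1.
have := lucas_lt b2 n; have := lucas_lt b2' n; rewrite !lucasSS => ? ?; split; first by lia.
have : ((Posz b - 2) * lucas b n.+1 <= (Posz b' - 2) * lucas b' n.+1)%R by nia.
lia.
Qed.

Lemma lucas_system_complete b a c : 3 < b -> Posz a = lucas b c ->
  exists r s t u v w x y z z1 z2 z3 z4,
    lucas_system b a c r s t u v w x y z z1 z2 z3 z4.
Proof.
move=> b3 Ea.
have b1 : 1 < b by lia.
have b2 : (2 <= Posz b)%R by lia.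
(* The index 6c + 1 makes u odd and larger than 2a and 2c; the index ku makes u^2 divide s. *)
set k := (6 * c).+1; set u := lucasn b k; set m := k * u.
have u_odd : odd u := lucasn_odd b c.
have u0 : 0 < u by case: (u) u_odd.
have uE : Posz u = lucas b k by rewrite lucasnE.
have ku : k <= u by have := lucas_geid b2 k; rewrite -uE; lia.
have au : 2 * a < u.
  case: (posnP c) => [c0|c0]; first by move: Ea; rewrite c0 lucas0; lia.
  have H1 : (lucas b c.+1 <= u)%R by rewrite uE; apply: lucas_le => //; rewrite /k; lia.
  have [c' Ec] : exists c', c = c'.+1 by exists c.-1; lia.
  have := lucas_ltS b2 c'; have := lucas_geid b2 c; move: H1 Ea; rewrite Ec lucasSS; nia.
have m0 : 0 < m by rewrite muln_gt0 u0.
set s := lucasn b m; set r := lucasn b m.-1.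
have [m' Em] : exists m', m = m'.+1 by exists m.-1; lia.
have sE : Posz s = lucas b m by rewrite lucasnE.
have rE : Posz r = lucas b m.-1 by rewrite lucasnE.
have rs : r < s by have := lucas_ltS b2 m'; move: sE rE; rewrite Em /=; lia.
have [z Ez] : exists z, s = u * u * z.
  have := lucas_sqr_dvdM b2 k; rewrite -uE absz_nat -sE => /dvdzP [z Hz].
  by exists `|z|%N; nia.
set v := b * s - 2 * r.
have vE : v + 2 * r = b * s by rewrite /v; nia.
have sv : 2 * s < v by nia.
have as_ : a <= s.
  by have : (lucas b c <= lucas b m)%R; [apply: lucas_le => //; rewrite /m /k; nia | lia].
(* A common divisor divides s, hence 2r; being odd it divides r, and r, s are coprime neighbours. *)
have co_uv : coprime v u.
  rewrite /coprime; set d := gcdn v u.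
  have dv : d %| v := dvdn_gcdl _ _; have du : d %| u := dvdn_gcdr _ _.
  have ds : d %| s by rewrite Ez -mulnA dvdn_mulr.
  have d2r : d %| 2 * r by rewrite -(dvdn_addr _ dv) vE dvdn_mull.
  have d_odd : odd d by exact: dvdn_odd du u_odd.
  have dr : d %| r by rewrite Gauss_dvdr // in d2r; rewrite coprimen2.
  have := @lucas_coprime b m' (Posz d); rewrite -[m']/(m'.+1.-1) -Em -rE -sE.
  by rewrite !dvdzE /= dvdn1; apply.
(* The added multiple of vu keeps both residues and makes w so large that z1 and z2 are natural
   numbers and x is at least a. *)
pose w := chinese v u b 2 + v * u * (b + 2).
have v0 : 0 < v by lia.
have wb : b + 2 <= w by rewrite /w (leq_trans _ (leq_addl _ _)) // leq_pmull // muln_gt0 v0.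
have [z1 Ez1] : exists z1, w = b + v * z1.
  have : b == w %[mod v].
    by rewrite /w addnC -mulnA mulnC modnMDl (chinese_modl co_uv).
  rewrite eq_sym eqn_mod_dvd; last by lia.
  by case/dvdnP => z1 Hz; exists z1; lia.
have [z2 Ez2] : exists z2, w = 2 + u * z2.
  have : 2 == w %[mod u].
    by rewrite /w addnC [v * u]mulnC -mulnA mulnC modnMDl (chinese_modr co_uv).
  rewrite eq_sym eqn_mod_dvd; last by lia.
  by case/dvdnP => z2 Hz; exists z2; lia.
have w1 : 1 < w by lia.
set x := lucasn w c; set y := lucasn w c.+1.
have xE : Posz x = lucas w c by rewrite lucasnE.
have Exy : x * x + y * y = w * x * y + 1 := lucasn_pell _ w1.
have ax : a <= x by have := lucas_le_param c b1 (_ : b <= w); rewrite -xE -Ea; lia.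
have [z3 Ez3] : exists z3, x = a + v * z3.
  apply: dvdz_addnP => //; rewrite xE Ea.
  by apply: lucas_mod; apply/dvdzP; exists (Posz z1); clear -Ez1; lia.
have [z4 Ez4] : exists z4, x = c + u * z4.
  apply: dvdz_addnP.
    by have := lucas_geid (_ : (2 <= Posz w)%R) c; rewrite -xE; lia.
  rewrite xE -(lucas2n c).
  by apply: lucas_mod; apply/dvdzP; exists (Posz z2); clear -Ez2; lia.
exists r, s, (lucasn b k.+1), u, v, w, x, y, z, z1, z2, z3, z4.
split; [|split]; split=> //.
- by rewrite lucasn_pell.
- by have := lucasn_pell m' b1; rewrite /s /r Em /=; lia.
- by lia.
- by rewrite /k in ku; lia.
Qed.
End LucasDiophantine.

(** * Definability by positive existential formulas *)

Section PositiveExistential.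
Local Open Scope nat_scope.
Variables (A : Type) (base : ((nat -> A) -> Prop) -> Prop).
Implicit Types (P Q : (nat -> A) -> Prop) (e x : nat -> A).

(** Bound variables take the first k places and shift the free ones. A block is a whole sequence of
    which k terms are read, which avoids dependent lengths. *)
Definition mix k x e : nat -> A := fun i => if i < k then x i else e (i - k).

Definition pos_ex P :=
  exists k Q, base Q /\ forall e, P e <-> exists x, Q (mix k x e).

Hypothesis base_and : forall P Q, base P -> base Q -> base (fun e => P e /\ Q e).
Hypothesis base_or : forall P Q, base P -> base Q -> base (fun e => P e \/ Q e).
Hypothesis base_rename : forall P (r : nat -> nat), base P -> base (fun e => P (e \o r)).

Lemma pos_ex_ext P Q : (forall e, P e <-> Q e) -> pos_ex P -> pos_ex Q.
Proof.
move=> PQ [k [B [bB HB]]]; exists k, B; split=> // e.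
by rewrite -PQ.
Qed.

Lemma pos_ex_base P : base P -> pos_ex P.
Proof.
move=> bP; exists 0, P; split=> // e; have E x : mix 0 x e = e.
  by apply/funext => i; rewrite /mix subn0.
by split=> [|[x]]; [exists e; rewrite E | rewrite E].
Qed.

Lemma pos_ex_rename P (r : nat -> nat) : pos_ex P -> pos_ex (fun e => P (fun i => e (r i))).
Proof.
move=> [k [B [bB HB]]].
pose r' i := if i < k then i else k + r (i - k).
exists k, (fun e => B (e \o r')); split; first exact: base_rename.
move=> e; rewrite HB; have E x : mix k x e \o r' = mix k x (fun i => e (r i)).
  apply/funext => i; rewrite /mix /r' /=; case: (ltnP i k) => [->//|ki].
  by rewrite ltnNge leq_addr /= addKn.
by split=> -[x Hx]; exists x; move: Hx; rewrite E.
Qed.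

Lemma pos_ex_merge k1 k2 x1 x2 e :
  let x i := if i < k1 then x1 i else x2 (i - k1) in
  let r1 i := if i < k1 then i else i + k2 in
  let r2 i := i + k1 in
  mix (k1 + k2) x e \o r1 = mix k1 x1 e /\ mix (k1 + k2) x e \o r2 = mix k2 x2 e.
Proof.
move=> x r1 r2; rewrite /x /r1 /r2 /mix; split; apply/funext => i /=.
  case: (ltnP i k1) => ik; first by rewrite ltn_addr // ik.
  by rewrite ltn_add2r ltnNge ik /= subnDr.
case: (ltnP i k2) => ik; first by rewrite addnC ltn_add2l ik ltnNge leq_addr /= addKn.
by rewrite addnC ltn_add2l ltnNge ik /= subnDl.
Qed.

Lemma pos_ex_and P Q : pos_ex P -> pos_ex Q -> pos_ex (fun e => P e /\ Q e).
Proof.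
move=> [k1 [B1 [b1 H1]]] [k2 [B2 [b2 H2]]].
pose r1 i := if i < k1 then i else i + k2; pose r2 i := i + k1.
exists (k1 + k2), (fun e => B1 (e \o r1) /\ B2 (e \o r2)).
split=> [|e]; first by apply: base_and; exact: base_rename.
rewrite H1 H2; split=> [[[x1 Hx1] [x2 Hx2]]|[x [Hx1 Hx2]]].
  exists (fun i => if i < k1 then x1 i else x2 (i - k1)).
  by have [-> ->] := pos_ex_merge k1 k2 x1 x2 e.
have E := pos_ex_merge k1 k2 x (fun i => x (i + k1)) e.
have Ex : (fun i => if i < k1 then x i else x (i - k1 + k1)) = x.
  by apply/funext => i; case: ltnP => // ki; rewrite subnK.
rewrite /= Ex in E; case: E => E1 E2.
by split; [exists x; rewrite -E1 | exists (fun i => x (i + k1)); rewrite -E2].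
Qed.

Lemma pos_ex_or P Q : pos_ex P -> pos_ex Q -> pos_ex (fun e => P e \/ Q e).
Proof.
move=> [k1 [B1 [b1 H1]]] [k2 [B2 [b2 H2]]].
pose r1 i := if i < k1 then i else i + k2; pose r2 i := i + k1.
exists (k1 + k2), (fun e => B1 (e \o r1) \/ B2 (e \o r2)).
split=> [|e]; first by apply: base_or; exact: base_rename.
rewrite H1 H2; split=> [[[x1 Hx1]|[x2 Hx2]]|[x Hx]].
(* [A] comes with no default element, so [e] supplies values for the block of the other disjunct. *)
- exists (fun i => if i < k1 then x1 i else e (i - k1)).
  by have [-> _] := pos_ex_merge k1 k2 x1 e e; left.
- exists (fun i => if i < k1 then e i else x2 (i - k1)).
  by have [_ ->] := pos_ex_merge k1 k2 e x2 e; right.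
have E := pos_ex_merge k1 k2 x (fun i => x (i + k1)) e.
have Ex : (fun i => if i < k1 then x i else x (i - k1 + k1)) = x.
  by apply/funext => i; case: ltnP => // ki; rewrite subnK.
rewrite /= Ex in E; case: E => E1 E2.
case: Hx => Hx; [left; exists x | right; exists (fun i => x (i + k1))].
  by rewrite -E1.
by rewrite -E2.
Qed.

Lemma pos_ex_ex (P : A -> (nat -> A) -> Prop) :
  pos_ex (fun e => P (e 0) (fun i => e i.+1)) -> pos_ex (fun e => exists a, P a e).
Proof.
move=> [k [B [bB HB]]]; exists k.+1, B; split=> // e.
pose cons a i := if i is i'.+1 then e i' else a.
have E x : mix k x (cons (x k)) = mix k.+1 x e.
  apply/funext => i; rewrite /mix ltnS.
  case: (ltngtP i k) => [//|ki|->]; last by rewrite subnn.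
  by rewrite -(subnSK ki).
split=> [[a Pa]|[x Bx]].
  have [x Hx] : exists x, B (mix k x (cons a)) by apply/HB.
  exists (fun i => if i < k then x i else a); rewrite -E ltnn.
  suff -> : mix k (fun i => if i < k then x i else a) (cons a) = mix k x (cons a) by [].
  by apply/funext => i; rewrite /mix; case: (i < k).
exists (x k); apply/(HB (cons (x k))); exists x.
by rewrite E.
Qed.

Lemma pos_ex_mix k P : pos_ex P -> pos_ex (fun e => exists a, P (mix k a e)).
Proof.
move=> [k' [B [bB HB]]]; exists (k' + k), B; split=> // e.
have E x a : mix k' x (mix k a e) = mix (k' + k) (fun i => if i < k' then x i else a (i - k')) e.
  apply/funext => i; rewrite /mix; case: (ltnP i k') => ik; first by rewrite ltn_addr.
  by rewrite -ltn_subLR // subnDA.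
split=> [[a /HB [x Bx]]|[x Bx]].
  by exists (fun i => if i < k' then x i else a (i - k')); rewrite -E.
exists (fun i => x (i + k')); apply/HB; exists x; rewrite E.
suff -> : (fun i => if i < k' then x i else x (i - k' + k')) = x by [].
by apply/funext => i; case: ltnP => // ki; rewrite subnK.
Qed.

End PositiveExistential.

(* [b : B] is represented by any [a : A] with [pi a = b]: for Diophantine sets [pi]
   is the identity of [nat], for instances of DP an exponent-sum. *)
Section Definability.
Local Open Scope nat_scope.
Variables (A B : Type) (pi : A -> B) (lift : B -> A).
Variable base : ((nat -> A) -> Prop) -> Prop.
Hypothesis liftK : cancel lift pi.
Hypothesis base_and : forall P Q, base P -> base Q -> base (fun e => P e /\ Q e).
Hypothesis base_or : forall P Q, base P -> base Q -> base (fun e => P e \/ Q e).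
Hypothesis base_rename : forall P (r : nat -> nat), base P -> base (fun e => P (e \o r)).

Definition definable (P : (nat -> B) -> Prop) := pos_ex base (fun e => P (pi \o e)).

Definition definable_fun (F : (nat -> B) -> B) :=
  definable (fun e => e 0 = F (fun i => e i.+1)).

Hypothesis definable_eq0 : definable (fun e => e 0 = e 1).

Lemma definable_ext P Q : (forall e, P e <-> Q e) -> definable P -> definable Q.
Proof. by move=> PQ; apply: pos_ex_ext => e; exact: PQ. Qed.

Lemma definable_rename P r : definable P -> definable (fun e => P (fun i => e (r i))).
Proof. exact: (@pos_ex_rename A base base_rename (fun e => P (pi \o e)) r). Qed.

Lemma definable_and P Q : definable P -> definable Q -> definable (fun e => P e /\ Q e).
Proof. exact: pos_ex_and. Qed.

Lemma definable_or P Q : definable P -> definable Q -> definable (fun e => P e \/ Q e).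
Proof. exact: pos_ex_or. Qed.

Lemma definable_ex (P : B -> (nat -> B) -> Prop) :
  definable (fun e => P (e 0) (fun i => e i.+1)) -> definable (fun e => exists b, P b e).
Proof.
move=> dP; apply: (pos_ex_ext (P := fun e => exists a, P (pi a) (pi \o e))).
  by move=> e; split=> -[b Pb]; [exists (pi b) | exists (lift b); rewrite liftK].
exact: (@pos_ex_ex A base (fun a e => P (pi a) (pi \o e))).
Qed.

Lemma definable_mix k P : definable P -> definable (fun e => exists a, P (mix k a e)).
Proof.
move=> /(pos_ex_mix k); apply: pos_ex_ext => e.
have E a : mix k (pi \o a) (pi \o e) = pi \o mix k a e.
  by apply/funext => i; rewrite /mix /=; case: ifP.
split=> -[a Pa]; first by exists (pi \o a); rewrite E.
exists (lift \o a); rewrite -E.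
by have -> : pi \o (lift \o a) = a by apply/funext => i /=; rewrite liftK.
Qed.

Lemma definable_subst (P : B -> (nat -> B) -> Prop) F :
  definable (fun e => P (e 0) (fun i => e i.+1)) -> definable_fun F ->
  definable (fun e => P (F e) e).
Proof.
move=> dP dF; apply: (definable_ext (P := fun e => exists a, a = F e /\ P a e)).
  by move=> e; split=> [[a [->]]|]//; exists (F e).
by apply: definable_ex; exact: (@definable_and (fun e => e 0 = F (fun i => e i.+1))).
Qed.

Lemma definable_fun_rename F r :
  definable_fun F -> definable_fun (fun e => F (fun i => e (r i))).
Proof.
move=> dF; pose r' i := if i is j.+1 then (r j).+1 else 0.
exact: (@definable_rename (fun e => e 0 = F (fun i => e i.+1)) r').
Qed.

Lemma definable_rel2 (R : B -> B -> Prop) F G : definable (fun e => R (e 0) (e 1)) ->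
  definable_fun F -> definable_fun G -> definable (fun e => R (F e) (G e)).
Proof.
move=> dR dF dG; apply: (@definable_subst (fun a e => R a (G e))) => //.
apply: (@definable_subst (fun a e => R (e 0) a) (fun e => G (fun i => e i.+1))).
  by apply: (@definable_rename (fun e => R (e 0) (e 1)) (fun i => 1 - i)).
exact: definable_fun_rename.
Qed.

Lemma definable_rel3 (R : B -> B -> B -> Prop) F G H :
  definable (fun e => R (e 0) (e 1) (e 2)) ->
  definable_fun F -> definable_fun G -> definable_fun H ->
  definable (fun e => R (F e) (G e) (H e)).
Proof.
move=> dR dF dG dH; apply: (@definable_subst (fun a e => R a (G e) (H e))) => //.
apply: (@definable_subst (fun a e => R (e 0) a (H (fun i => e i.+1)))
   (fun e => G (fun i => e i.+1))); last exact: definable_fun_rename.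
apply: (@definable_subst (fun a e => R (e 1) (e 0) a) (fun e => H (fun i => e i.+2))).
  by apply: (@definable_rename (fun e => R (e 0) (e 1) (e 2)) (fun i => 2 - i)).
exact: (@definable_fun_rename H (fun i => i.+2)).
Qed.

Lemma definable_fun_var i : definable_fun (fun e => e i).
Proof.
exact: (@definable_rename (fun e => e 0 = e 1) (fun j => if j is 0 then 0 else i.+1)).
Qed.

Lemma definable_eq F G :
  definable_fun F -> definable_fun G -> definable (fun e => F e = G e).
Proof. exact: (@definable_rel2 (fun x y => x = y)). Qed.

Lemma definable_op1 (op : B -> B) F :
  definable (fun e => e 0 = op (e 1)) -> definable_fun F ->
  definable_fun (fun e => op (F e)).
Proof.
move=> dop dF; apply: (@definable_rel2 (fun x y => x = op y) (fun e => e 0)) => //.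
exact: (@definable_fun_rename F S).
Qed.

Lemma definable_op2 (op : B -> B -> B) F G :
  definable (fun e => e 0 = op (e 1) (e 2)) -> definable_fun F -> definable_fun G ->
  definable_fun (fun e => op (F e) (G e)).
Proof.
move=> dop dF dG; apply: (@definable_rel3 (fun x y z => x = op y z) (fun e => e 0)) => //.
- exact: (@definable_fun_rename F S).
- exact: (@definable_fun_rename G S).
Qed.

End Definability.

(** * Diophantine sets and functions of natural numbers *)

Section Diophantine.
Local Open Scope nat_scope.

Inductive pexp :=
  | PVar of nat | PConst of nat | PAdd of pexp & pexp | PMul of pexp & pexp.

Fixpoint peval (e : nat -> nat) p :=
  match p with
  | PVar i => e i
  | PConst n => n
  | PAdd p q => peval e p + peval e q
  | PMul p q => peval e p * peval e q
  end.

Fixpoint prename (r : nat -> nat) p :=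
  match p with
  | PVar i => PVar (r i)
  | PConst n => PConst n
  | PAdd p q => PAdd (prename r p) (prename r q)
  | PMul p q => PMul (prename r p) (prename r q)
  end.

Lemma peval_rename r e p : peval e (prename r p) = peval (e \o r) p.
Proof. by elim: p => //= p -> q ->. Qed.

Definition poly_eq (P : (nat -> nat) -> Prop) :=
  exists L R, forall e, P e <-> peval e L = peval e R.

Lemma poly_eq_rename P (r : nat -> nat) : poly_eq P -> poly_eq (fun e => P (e \o r)).
Proof.
move=> [L [R H]]; exists (prename r L), (prename r R) => e.
by rewrite !peval_rename.
Qed.

(** The equation (L1 - R1)^2 + (L2 - R2)^2 = 0 with the negative terms moved across, since
    coefficients are natural numbers. *)
Lemma poly_eq_and P Q : poly_eq P -> poly_eq Q -> poly_eq (fun e => P e /\ Q e).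
Proof.
move=> [L1 [R1 H1]] [L2 [R2 H2]].
exists (PAdd (PAdd (PMul L1 L1) (PMul R1 R1)) (PAdd (PMul L2 L2) (PMul R2 R2))).
exists (PMul (PConst 2) (PAdd (PMul L1 R1) (PMul L2 R2))) => e /=.
rewrite H1 H2; move: (peval e _) (peval e _) (peval e _) (peval e _) => d c b a.
split=> [[-> ->]|E]; first by lia.
have /eqP : ((Posz a - Posz b) ^+ 2 + (Posz c - Posz d) ^+ 2 = 0)%R by rewrite !expr2; lia.
by rewrite paddr_eq0 ?sqr_ge0 // !sqrf_eq0 => /andP[/eqP ? /eqP ?]; lia.
Qed.

(** Likewise (L1 - R1)(L2 - R2) = 0. *)
Lemma poly_eq_or P Q : poly_eq P -> poly_eq Q -> poly_eq (fun e => P e \/ Q e).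
Proof.
move=> [L1 [R1 H1]] [L2 [R2 H2]].
exists (PAdd (PMul L1 L2) (PMul R1 R2)), (PAdd (PMul L1 R2) (PMul R1 L2)) => e /=.
rewrite H1 H2; move: (peval e _) (peval e _) (peval e _) (peval e _) => d c b a.
split=> [[->|->]|E]; [by lia | by lia |].
have /eqP : ((Posz a - Posz b) * (Posz c - Posz d) = 0)%R by lia.
by rewrite mulf_eq0 => /orP[/eqP ?|/eqP ?]; [left | right]; lia.
Qed.

Definition dio := definable id poly_eq.

Definition diof := definable_fun id poly_eq.

Implicit Types (P Q R T U : (nat -> nat) -> Prop) (F G H : (nat -> nat) -> nat).

Lemma dio_ext P Q : (forall e, P e <-> Q e) -> dio P -> dio Q.
Proof. exact: definable_ext. Qed.

Lemma dio_peval (L R : pexp) : dio (fun e => peval e L = peval e R).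
Proof. by apply: pos_ex_base; exists L, R. Qed.

Let eq0 : dio (fun e => e 0 = e 1) := dio_peval (PVar 0) (PVar 1).
Let idK : cancel (@id nat) id. Proof. by []. Qed.

Lemma dio_rename P r : dio P -> dio (fun e => P (fun i => e (r i))).
Proof. exact/definable_rename/poly_eq_rename. Qed.

Lemma dio_and P Q : dio P -> dio Q -> dio (fun e => P e /\ Q e).
Proof. exact: (definable_and poly_eq_and poly_eq_rename). Qed.

Lemma dio_and3 P Q R : dio P -> dio Q -> dio R -> dio (fun e => [/\ P e, Q e & R e]).
Proof.
move=> dP dQ dR; apply: (dio_ext (P := fun e => P e /\ Q e /\ R e)).
  by move=> e; split=> [[? []]|[]].
by do !apply: dio_and.
Qed.

Lemma dio_and4 P Q R T : dio P -> dio Q -> dio R -> dio T ->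
  dio (fun e => [/\ P e, Q e, R e & T e]).
Proof.
move=> dP dQ dR dT; apply: (dio_ext (P := fun e => P e /\ [/\ Q e, R e & T e])).
  by move=> e; split=> [[? []]|[]].
by apply: dio_and => //; exact: dio_and3.
Qed.

Lemma dio_and5 P Q R T U : dio P -> dio Q -> dio R -> dio T -> dio U ->
  dio (fun e => [/\ P e, Q e, R e, T e & U e]).
Proof.
move=> dP dQ dR dT dU; apply: (dio_ext (P := fun e => P e /\ [/\ Q e, R e, T e & U e])).
  by move=> e; split=> [[? []]|[]].
by apply: dio_and => //; exact: dio_and4.
Qed.

Lemma dio_or P Q : dio P -> dio Q -> dio (fun e => P e \/ Q e).
Proof. exact: (definable_or poly_eq_or poly_eq_rename). Qed.

Lemma dio_ex (P : nat -> (nat -> nat) -> Prop) :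
  dio (fun e => P (e 0) (fun i => e i.+1)) -> dio (fun e => exists a, P a e).
Proof. exact: (definable_ex idK). Qed.

Lemma dio_mix k P : dio P -> dio (fun e => exists a, P (mix k a e)).
Proof. exact: (definable_mix idK). Qed.

Lemma diof_rename F r : diof F -> diof (fun e => F (fun i => e (r i))).
Proof. exact/definable_fun_rename/poly_eq_rename. Qed.

Lemma dio_rel2 (R : nat -> nat -> Prop) F G :
  dio (fun e => R (e 0) (e 1)) -> diof F -> diof G -> dio (fun e => R (F e) (G e)).
Proof. exact: (definable_rel2 idK poly_eq_and poly_eq_rename). Qed.

Lemma dio_rel3 (R : nat -> nat -> nat -> Prop) F G H :
  dio (fun e => R (e 0) (e 1) (e 2)) -> diof F -> diof G -> diof H ->
  dio (fun e => R (F e) (G e) (H e)).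
Proof. exact: (definable_rel3 idK poly_eq_and poly_eq_rename). Qed.

Lemma diof_op1 (op : nat -> nat) F :
  dio (fun e => e 0 = op (e 1)) -> diof F -> diof (fun e => op (F e)).
Proof. exact: (definable_op1 idK poly_eq_and poly_eq_rename eq0). Qed.

Lemma diof_op2 (op : nat -> nat -> nat) F G :
  dio (fun e => e 0 = op (e 1) (e 2)) -> diof F -> diof G ->
  diof (fun e => op (F e) (G e)).
Proof. exact: (definable_op2 idK poly_eq_and poly_eq_rename eq0). Qed.

Lemma dio_eq F G : diof F -> diof G -> dio (fun e => F e = G e).
Proof. exact: (definable_eq idK poly_eq_and poly_eq_rename eq0). Qed.

Lemma diof_var i : diof (fun e => e i).
Proof. exact: (definable_fun_var poly_eq_rename eq0 i). Qed.

Lemma diof_const n : diof (fun=> n).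
Proof. exact: (dio_peval (PVar 0) (PConst n)). Qed.

Lemma diof_add F G : diof F -> diof G -> diof (fun e => F e + G e).
Proof. by apply: diof_op2; apply: (dio_peval (PVar 0) (PAdd (PVar 1) (PVar 2))). Qed.

Lemma diof_mul F G : diof F -> diof G -> diof (fun e => F e * G e).
Proof. by apply: diof_op2; apply: (dio_peval (PVar 0) (PMul (PVar 1) (PVar 2))). Qed.

Lemma diof_succ F : diof F -> diof (fun e => (F e).+1).
Proof. by apply: (@diof_op1 succn); apply: (dio_peval (PVar 0) (PAdd (PConst 1) (PVar 1))). Qed.

End Diophantine.

Section DiophantineRelations.
Local Open Scope nat_scope.
Implicit Types F G : (nat -> nat) -> nat.

Lemma dio_le F G : diof F -> diof G -> dio (fun e => F e <= G e).
Proof.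
apply: (@dio_rel2 leq); apply: (dio_ext (P := fun e => exists z, e 1 = e 0 + z)).
  by move=> e; split=> [[z ->]|le]; [exact: leq_addr | exists (e 1 - e 0); rewrite subnKC].
by apply: dio_ex; apply: dio_eq; [exact: diof_var | apply: diof_add; exact: diof_var].
Qed.

Lemma dio_lt F G : diof F -> diof G -> dio (fun e => F e < G e).
Proof. by move=> dF dG; apply: dio_le => //; exact: diof_succ. Qed.

Lemma dio_neq F G : diof F -> diof G -> dio (fun e => F e <> G e).
Proof.
move=> dF dG; apply: (dio_ext (P := fun e => F e < G e \/ G e < F e)).
  by move=> e; lia.
by apply: dio_or; exact: dio_lt.
Qed.

Lemma dio_dvd F G : diof F -> diof G -> dio (fun e => F e %| G e).
Proof.
apply: (@dio_rel2 dvdn); apply: (dio_ext (P := fun e => exists z, e 1 = z * e 0)).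
  by move=> e; split=> /dvdnP.
by apply: dio_ex; apply: dio_eq; [exact: diof_var | apply: diof_mul; exact: diof_var].
Qed.
End DiophantineRelations.

(* [diof] unfolds to [dio], so each lemma is only tried on its own head. *)
Ltac diof_op := fail.
Ltac dio_tac :=
  lazymatch goal with
  | |- dio (fun e => _ /\ _) => apply dio_and; dio_tac
  | |- dio (fun e => [/\ _, _ & _]) => apply dio_and3; dio_tac
  | |- dio (fun e => [/\ _, _, _ & _]) => apply dio_and4; dio_tac
  | |- dio (fun e => [/\ _, _, _, _ & _]) => apply dio_and5; dio_tac
  | |- dio (fun e => _ \/ _) => apply dio_or; dio_tac
  | |- dio (fun e => exists _, _) => apply dio_ex; cbn beta; dio_tac
  | |- dio (fun e => _ = _ :> nat) => apply dio_eq; dio_tac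
  | |- dio _ =>
      first [ assumption
            | first [apply dio_lt | apply dio_le | apply dio_neq | apply dio_dvd]; dio_tac
            | idtac ]
  | |- diof (fun e => e _) => apply diof_var
  | |- diof (fun e => _ + _)%N => apply diof_add; dio_tac
  | |- diof (fun e => _ * _)%N => apply diof_mul; dio_tac
  | |- diof _ =>
      first [assumption | apply diof_const | diof_op; dio_tac | apply diof_succ; dio_tac | idtac]
  end.

(** * Exponentiation is Diophantine *)

Section DiophantineExponentiation.
Local Open Scope nat_scope.
Implicit Types F G H : (nat -> nat) -> nat.

Definition is_lucas b n a := 3 < b /\ a = lucasn b n.

Lemma dio_lucas F G H : diof F -> diof G -> diof H ->
  dio (fun e => is_lucas (F e) (G e) (H e)).
Proof.
apply: (@dio_rel3 is_lucas).
apply: (dio_ext (P := fun e => 3 < e 0 /\ exists r s t u v w x y z z1 z2 z3 z4,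
    lucas_system (e 0) (e 2) (e 1) r s t u v w x y z z1 z2 z3 z4)).
  move=> e; split=> -[b3 H1]; split=> //.
    move: H1 => [r [s [t [u [v [w [x [y [z [z1 [z2 [z3 [z4 H1]]]]]]]]]]]]].
    by have := lucas_system_sound b3 H1; rewrite -lucasnE; lia.
  by apply: lucas_system_complete => //; rewrite H1 lucasnE; lia.
by rewrite /lucas_system; dio_tac.
Qed.

Lemma PoszX p n : Posz (p ^ n) = (Posz p ^+ n)%R.
Proof. by elim: n => // n IH; rewrite expnS PoszM IH exprS. Qed.

(* [b] is taken so large that the modulus [m] of [lucas_exp] exceeds both [q]
   and [p ^ n]. *)
Lemma dio_exp_spec p n q : q = p ^ n <->
  [\/ p = 0 /\ (n = 0 /\ q = 1 \/ 0 < n /\ q = 0) |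
      0 < p /\ exists h b x y m z,
      [/\ is_lucas (p + 4) n.+1 h, b = h + q + p * p + p + 4,
       is_lucas b n x, is_lucas b n.+1 y &
       m + p * p + 1 = p * b /\
       (q + b * x = y + p * x + m * z \/ q + b * x + m * z = y + p * x)]].
Proof.
case: (posnP p) => [->|p0].
  split=> [->|[[_ [[-> ->]|[n0 ->]]]|[]]] //; last by rewrite exp0n.
  by left; split=> //; case: n => [|n]; [left | right; rewrite exp0n].
have key h b m : h = lucasn (p + 4) n.+1 -> b = h + q + p * p + p + 4 ->
    m + p * p + 1 = p * b -> [/\ 3 < b, p ^ n < m, q < m &
      (Posz m %| Posz (p ^ n) + Posz b * Posz (lucasn b n)
         - (Posz (lucasn b n.+1) + Posz p * Posz (lucasn b n)))%Z%R].
  move=> Eh Eb Em.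
  (* [h] is a bound on p^n that can be defined before exponentiation is: U_{n+1} with parameter p +
     4 is at least (p + 3)^n. *)
  have hp : p ^ n <= h.
    have := lucas_ge_exp (_ : (2 <= Posz (p + 4))%R) n.
    rewrite -lucasnE -?Eh; last by lia.
    have -> : (Posz (p + 4) - 1)%R = Posz (p + 3) by lia.
    rewrite -PoszX => H.
    have : p ^ n <= (p + 3) ^ n by case: (n) => // k; rewrite leq_exp2r // leq_addr.
    lia.
  have hm : h + q < m.
    have : 1 * (h + q + p * p + 4) <= p * (h + q + p * p + 4) by rewrite leq_mul2r p0 orbT.
    lia.
  split; [lia | lia | lia |].
  have -> : Posz m = (Posz p * Posz b - Posz p * Posz p - 1)%R by lia.
  have b1 : 1 < b by lia.
  by rewrite !lucasnE // PoszX; exact: lucas_exp.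
split=> [Eq|].
  right; split=> //; set h := lucasn (p + 4) n.+1; set b := h + q + p * p + p + 4.
  have [m Em] : exists m, m + p * p + 1 = p * b.
    exists (p * (h + q + p * p + 3) + (p - 1)); rewrite /b; lia.
  have [b3 _ _ /dvdzP [z]] := key h b m erefl erefl Em.
  rewrite -Eq => Hz; exists h, b, (lucasn b n), (lucasn b n.+1), m, `|z|%N.
  split=> //; first by split=> //; lia.
  split=> //; clear -Hz.
  by have [z0|z0] := lerP 0 z; [left | right]; nia.
case=> [[p_eq0]|[_ [h [b [x [y [m [z [[_ Eh] Eb [_ Ex] [_ Ey] [Em Hz]]]]]]]]]]; first by lia.
have [_ pm qm] := key h b m Eh Eb Em; rewrite -Ex -Ey => /dvdzP [z' Hz'].
suff /dvdz_small : (Posz m %| (Posz q - Posz (p ^ n))%R)%Z by clear -pm qm; lia.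
apply/dvdzP; clear -Hz Hz'; case: Hz => Hz; [exists (Posz z - z')%R | exists (- Posz z - z')%R]; lia.
Qed.

Lemma diof_exp F G : diof F -> diof G -> diof (fun e => F e ^ G e).
Proof.
apply: (@diof_op2 expn).
apply: dio_ext (fun e => iff_sym (dio_exp_spec (e 1) (e 2) (e 0))) _.
by dio_tac; apply: dio_lucas; dio_tac.
Qed.
End DiophantineExponentiation.

(** * Binomial coefficients, factorials and the beta function *)

Section Arithmetic.
Local Open Scope nat_scope.

Lemma digit_sum B m k (c : nat -> nat) : (forall i, c i < B) ->
  (\sum_(i < m) c i * B ^ i) %/ B ^ k %% B = if k < m then c k else 0.
Proof.
move=> cB; have B0 : 0 < B := leq_ltn_trans (leq0n _) (cB 0).
elim: m k c cB => [|m IH] k c cB; first by rewrite big_ord0 div0n mod0n.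
have E : \sum_(i < m.+1) c i * B ^ i = (\sum_(i < m) c i.+1 * B ^ i) * B + c 0.
  rewrite big_ord_recl expn0 muln1 addnC big_distrl /=; congr (_ + _).
  by apply: eq_bigr => i _; rewrite /bump /= add1n expnSr mulnA.
rewrite E; case: k => [|k]; first by rewrite expn0 divn1 modnMDl modn_small.
by rewrite expnS divnMA divnMDl // (divn_small (cB 0)) addn0 (IH k (fun i => c i.+1)).
Qed.

Lemma bin_le_exp2 n k : 'C(n, k) <= 2 ^ n.
Proof.
elim: n k => [|n IH] [|k]; rewrite ?bin0 ?expn_gt0 //.
by rewrite binS expnS mul2n -addnn leq_add.
Qed.

(** In base B = 2^{n+1} the digits of (B + 1)^n are the binomial coefficients, which are at most
    2^n. *)
Lemma bin_digit n k :
  'C(n, k) = ((2 ^ n.+1 + 1) ^ n %/ (2 ^ n.+1) ^ k) %% 2 ^ n.+1.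
Proof.
have -> : (2 ^ n.+1 + 1) ^ n = \sum_(i < n.+1) 'C(n, i) * (2 ^ n.+1) ^ i.
  by rewrite addnC expnDn; apply: eq_bigr => i _; rewrite exp1n mul1n.
rewrite (@digit_sum _ _ _ (fun i => 'C(n, i))); last first.
  by move=> i; rewrite (leq_ltn_trans (bin_le_exp2 n i)) // ltn_exp2l.
by case: ltnP => // /bin_small ->.
Qed.

Lemma ffact_le_exp r k : r ^_ k <= r ^ k.
Proof. by elim: k => // k IH; rewrite ffactnSr expnSr leq_mul // leq_subr. Qed.

(** The falling factorial falls short of r^k by at most k^2 r^{k-1}; the factor r avoids the
    exponent k - 1. *)
Lemma exp_ffact_bound r k : k <= r -> r * r ^ k <= r * r ^_ k + k * k * r ^ k.
Proof.
elim: k => [|k IH] kr; first by rewrite expn0 ffactn0 addn0.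
have := IH (ltnW kr); rewrite ffactnSr expnSr.
have := ffact_le_exp r k; have [d Ed] : exists d, r = k + d by exists (r - k); lia.
have -> : r - k = d by lia.
move: (r ^ k) (r ^_ k) => P F FP H.
have H1 : r * (r * P) <= r * (r * F + k * k * P) by rewrite leq_mul2l; nia.
have : r * (k * F) <= r * (k * P) by rewrite leq_mul2l leq_mul2l FP !orbT.
nia.
Qed.

Lemma fact_le_exp n : n`! <= n.+1 ^ n.
Proof.
elim: n => // n IH; rewrite factS expnS.
rewrite leq_mul // (leq_trans IH) //.
by case: (n) => // k; rewrite leq_exp2r.
Qed.

(** The falling factorial of r is C(r, n) n!, so r^n / C(r, n) approaches n! from above as r grows,
    the defect of the falling factorial being at most the fraction n^2 / r of r^n. The chosen r
    exceeds (n! + 1) n^2, which keeps the quotient below n! + 1. *)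
Lemma fact_quotient n (r := 2 * n.+1 ^ n.+2) : n`! = r ^ n %/ 'C(r, n).
Proof.
have nr : n <= r.
  apply: leq_trans (leqnSn n) _; rewrite /r !expnS.
  by have : 0 < n.+1 ^ n by [rewrite expn_gt0]; nia.
have C0 : 0 < 'C(r, n) by rewrite bin_gt0.
have E : 'C(r, n) * n`! = r ^_ n := bin_ffact r n.
have lo : n`! * 'C(r, n) <= r ^ n by rewrite mulnC E ffact_le_exp.
have hi : r ^ n < n`!.+1 * 'C(r, n).
  rewrite ltnNge; apply/negP => H.
  have := exp_ffact_bound nr; rewrite -E => H2.
  have rlt : n`!.+1 * (n * n) < r.
    have := fact_le_exp n; rewrite /r !expnS => H3.
    have H4 : n`!.+1 <= 2 * n.+1 ^ n.
      by have : 0 < n.+1 ^ n by [rewrite expn_gt0]; lia.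
    have H5 : n`!.+1 * (n * n) <= 2 * n.+1 ^ n * (n * n) by rewrite leq_mul2r H4 orbT.
    by have : 0 < n.+1 ^ n by [rewrite expn_gt0]; nia.
  have P0 : 0 < r ^ n by rewrite expn_gt0; lia.
  move: (r ^ n) 'C(r, n) n`! P0 C0 H H2 rlt => P C f P0 C0 H H2 rlt.
  have H6 : r * (f * (f.+1 * C)) <= r * (f * P) by rewrite !leq_mul2l H !orbT.
  have H7 : f.+1 * (r * P) <= f.+1 * (r * (C * f) + n * n * P) by rewrite leq_mul2l H2 orbT.
  have H8 : f.+1 * (n * n) * P < r * P by rewrite ltn_mul2r P0 rlt.
  have : f.+1 * (r * P) = r * (f * P) + r * P by lia.
  have : f.+1 * (r * (C * f) + n * n * P) = r * (f * (f.+1 * C)) + f.+1 * (n * n) * P by lia.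
  lia.
by apply/eqP; rewrite eqn_leq leq_divRL // lo /= -ltnS ltn_divLR.
Qed.

Lemma coprime_no_prime m n : 0 < m ->
  (forall p, prime p -> p %| m -> p %| n -> False) -> coprime m n.
Proof.
move=> m0 H; rewrite /coprime; have [//|g1] := eqVneq (gcdn m n) 1.
have g0 : 0 < gcdn m n by rewrite gcdn_gt0 m0.
have pg := pdiv_prime (_ : 1 < gcdn m n).
have dg := pdiv_dvd (gcdn m n).
case: (H _ (pg _)); first by lia.
  exact: dvdn_trans dg (dvdn_gcdl _ _).
exact: dvdn_trans dg (dvdn_gcdr _ _).
Qed.

Lemma chinese_seq (n : nat) (m a : nat -> nat) :
  (forall i j, i < n -> j < n -> i != j -> coprime (m i) (m j)) ->
  exists x, forall i, i < n -> x = a i %[mod m i].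
Proof.
elim: n => [|n IH] co; first by exists 0.
have [|x Hx] := IH; first by move=> i j ? ? ?; apply: co => //; lia.
have cop : coprime (\prod_(i < n) m i) (m n).
  by apply: (big_ind (fun p => coprime p (m n))) => [|p q Hp Hq|i _];
    rewrite ?coprime1n ?coprimeMl ?Hp ?Hq //; apply: co; have := ltn_ord i; lia.
exists (chinese (\prod_(i < n) m i) (m n) x (a n)) => i.
rewrite ltnS leq_eqVlt => /orP[/eqP->|ltin]; first exact: chinese_modr.
rewrite -Hx //; have := chinese_modl cop x (a n); set y := chinese _ _ _ _ => Hy.
have dm : m i %| \prod_(j < n) m j by rewrite (bigD1 (Ordinal ltin)) //= dvdn_mulr.
by rewrite -(modn_dvdm y dm) Hy modn_dvdm.
Qed.

Lemma dvdn_prod_coprime (n : nat) (m : nat -> nat) x :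
  (forall i j, i < n -> j < n -> i != j -> coprime (m i) (m j)) ->
  (forall i, i < n -> m i %| x) -> \prod_(i < n) m i %| x.
Proof.
elim: n => [|n IH] co dv; first by rewrite big_ord0 dvd1n.
rewrite big_ord_recr /= Gauss_dvd ?dv // ?IH //.
- by move=> i j ? ? ?; apply: co => //; lia.
- by move=> i ?; apply: dv; lia.
apply: (big_ind (fun p => coprime p (m n))) => [|p q Hp Hq|i _];
    rewrite ?coprime1n ?coprimeMl ?Hp ?Hq //; apply: co; have := ltn_ord i; lia.
Qed.

Definition beta u v i := u %% (1 + i.+1 * v).

(** With v = M! for an M at least n and at least every s i, each modulus exceeds the value it has to
    hold, and a prime dividing two moduli would divide (i - j)v, hence v, hence 1. *)
Lemma beta_seq (n : nat) (s : nat -> nat) :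
  exists u v, forall i, i < n -> beta u v i = s i.
Proof.
pose M := n + \sum_(i < n) s i; pose v := M`!.
have sM i : i < n -> s i < 1 + i.+1 * v.
  move=> lin; have : s i <= M.
    by rewrite /M (bigD1 (Ordinal lin)) //=; lia.
  by have := fact_geq M; rewrite -/v; nia.
have co i j : i < n -> j < n -> i != j -> coprime (1 + i.+1 * v) (1 + j.+1 * v).
  move=> lin ljn nij; apply: coprime_no_prime => // p pp pi pj.
  have npv : ~~ (p %| v).
    apply/negP => pv; have : p %| 1 by rewrite -(dvdn_addl _ (dvdn_mull i.+1 pv)).
    by rewrite dvdn1 => /eqP p1; rewrite p1 in pp.
  (* One of the truncated differences is zero, so this is |i - j| v. *)
  have : p %| (i - j) * v + (j - i) * v.
    have [lt_ij|le_ji] := ltnP i j.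
      have -> : (i - j) * v + (j - i) * v = 1 + j.+1 * v - (1 + i.+1 * v).
        by rewrite subnDl -mulnBl subSS (eqP (ltnW lt_ij : i - j == 0)) mul0n.
      exact: dvdn_sub.
    have -> : (i - j) * v + (j - i) * v = 1 + i.+1 * v - (1 + j.+1 * v).
      by rewrite subnDl -mulnBl subSS (eqP (le_ji : j - i == 0)) mul0n addn0.
    exact: dvdn_sub.
  rewrite -mulnDl Euclid_dvdM // (negPf npv) orbF => pd.
  have ij0 : 0 < i - j + (j - i) by clear -nij; lia.
  have ple : p <= M.
    by apply: leq_trans (dvdn_leq ij0 pd) _; rewrite /M; clear -lin ljn; lia.
  by case/negP: npv; rewrite /v dvdn_fact // ple prime_gt0.
have [u Hu] := chinese_seq s co.
by exists u, v => i lin; rewrite /beta Hu // modn_small ?sM.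
Qed.
End Arithmetic.

(** * Diophantine division, remainder and truncated subtraction *)

Section DiophantineArithmetic.
Local Open Scope nat_scope.
Implicit Types F G : (nat -> nat) -> nat.

Lemma diof_div F G : diof F -> diof G -> diof (fun e => F e %/ G e).
Proof.
apply: (@diof_op2 divn); apply: (dio_ext (P := fun e => e 2 = 0 /\ e 0 = 0 \/
  exists r, r < e 2 /\ e 1 = e 0 * e 2 + r)); last by dio_tac.
move=> e; split=> [[[-> ->]|[r [lt ->]]]|->]; first by rewrite divn0.
  by rewrite divnMDl ?divn_small ?addn0 //; lia.
case: (posnP (e 2)) => [->|e20]; [by left | right].
by exists (e 1 %% e 2); rewrite ltn_mod -divn_eq.
Qed.

Lemma diof_mod F G : diof F -> diof G -> diof (fun e => F e %% G e).
Proof.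
apply: (@diof_op2 modn); apply: (dio_ext (P := fun e => e 2 = 0 /\ e 0 = e 1 \/
  e 0 < e 2 /\ exists q, e 1 = q * e 2 + e 0)); last by dio_tac.
move=> e; split=> [[[-> ->]|[lt [q ->]]]|->]; first by rewrite modn0.
  by rewrite modnMDl modn_small.
case: (posnP (e 2)) => [->|e20]; [by left; rewrite modn0 | right].
by rewrite ltn_mod; split=> //; exists (e 1 %/ e 2); rewrite -divn_eq.
Qed.

Lemma diof_sub F G : diof F -> diof G -> diof (fun e => F e - G e).
Proof.
apply: (@diof_op2 subn); apply: (dio_ext (P := fun e =>
  e 1 = e 2 + e 0 \/ e 1 <= e 2 /\ e 0 = 0)); last by dio_tac.
by move=> e; lia.
Qed.

End DiophantineArithmetic.

Ltac diof_op ::= first [apply diof_div | apply diof_mod | apply diof_sub | apply diof_exp].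

(** * Diophantine binomial coefficients and factorials *)

Section DiophantineFactorials.
Local Open Scope nat_scope.
Implicit Types F G H : (nat -> nat) -> nat.

Lemma diof_bin F G : diof F -> diof G -> diof (fun e => 'C(F e, G e)).
Proof.
move=> dF dG; rewrite (_ : (fun e => _) =
  (fun e => ((2 ^ (F e).+1 + 1) ^ F e %/ (2 ^ (F e).+1) ^ G e) %% 2 ^ (F e).+1)).
  by dio_tac.
by apply/funext => e; exact: bin_digit.
Qed.

Lemma diof_fact F : diof F -> diof (fun e => (F e)`!).
Proof.
move=> dF; rewrite (_ : (fun e => _) = (fun e => (2 * (F e).+1 ^ (F e).+2) ^ F e
   %/ 'C(2 * (F e).+1 ^ (F e).+2, F e))).
  by apply: diof_div; last apply: diof_bin; dio_tac.
by apply/funext => e; exact: fact_quotient.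
Qed.

Lemma diof_ffact F G : diof F -> diof G -> diof (fun e => F e ^_ G e).
Proof.
move=> dF dG; rewrite (_ : (fun e => _) = (fun e => 'C(F e, G e) * (G e)`!)).
  by apply: diof_mul; [exact: diof_bin | exact: diof_fact].
by apply/funext => e; rewrite bin_ffact.
Qed.

Lemma diof_beta F G H : diof F -> diof G -> diof H -> diof (fun e => beta (F e) (G e) (H e)).
Proof. by move=> dF dG dH; rewrite /beta; dio_tac. Qed.
End DiophantineFactorials.

Ltac diof_op ::=
  first [apply diof_div | apply diof_mod | apply diof_sub | apply diof_exp
        | apply diof_bin | apply diof_fact | apply diof_ffact | apply diof_beta].

(** * Bounded universal quantifiers *)

Section BoundedQuantifier.
Local Open Scope nat_scope.

Definition scons T (a : T) (e : nat -> T) i := if i is i'.+1 then e i' else a.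

Fixpoint pvars p :=
  match p with
  | PVar i => i.+1
  | PConst _ => 0
  | PAdd p q | PMul p q => maxn (pvars p) (pvars q)
  end.

Lemma peval_le p v w : (forall i, i < pvars p -> v i <= w i) -> peval v p <= peval w p.
Proof.
elim: p => [i|n|p IHp q IHq|p IHp q IHq] //= H; first exact: H.
  by apply: leq_add; [apply: IHp | apply: IHq] => i Hi; apply: H; rewrite leq_max Hi ?orbT.
by apply: leq_mul; [apply: IHp | apply: IHq] => i Hi; apply: H; rewrite leq_max Hi ?orbT.
Qed.

Lemma peval_mod p v w m : (forall i, v i = w i %[mod m]) -> peval v p = peval w p %[mod m].
Proof.
move=> H; elim: p => [i|n|p IHp q IHq|p IHp q IHq] //=.
  by rewrite -modnDm IHp IHq modnDm.
by rewrite -modnMm IHp IHq modnMm.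
Qed.

Lemma eqn_mod_dist x y m : (x == y %[mod m]) = (m %| (x - y) + (y - x)).
Proof.
have [xy|yx] := leqP x y; last by rewrite eqn_mod_dvd ?(ltnW yx) // (eqP (ltnW yx : y - x == 0)) addn0.
by rewrite eq_sym eqn_mod_dvd // (eqP (xy : x - y == 0)).
Qed.

(* The moduli [1 + N %/ k.+1] replace the [1 + (k + 1) t] of the usual proof:
   their product is a binomial coefficient, so no Diophantine definition of
   a general product is needed. *)
Lemma bin_prod_moduli N y : (forall k, k < y -> k.+1 %| N) ->
  'C(N + y, y) = \prod_(k < y) (1 + N %/ k.+1).
Proof.
elim: y => [|y IH] dv; first by rewrite bin0 big_ord0.
rewrite big_ord_recr /= -IH; last by move=> k ky; apply: dv; lia.
apply/eqP; rewrite -(eqn_pmul2l (ltn0Sn y)); apply/eqP.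
rewrite -mul_bin_diag addnS /= mulnC [RHS]mulnC -mulnA; congr (_ * _).
by rewrite mulnDl mul1n divnK ?dv // addnC addSn.
Qed.

Section Moduli.
Variables (Q y : nat).
Hypothesis yQ : y <= Q.
(** The square keeps N / (k + 1) a multiple of Q! for k < y, so that no prime up to Q divides 1 + N
    / (k + 1). *)
Let N := Q`! * Q`!.
Let m k := 1 + N %/ k.+1.

Lemma dvdn_modulus_base k : k < y -> k.+1 %| N.
Proof. by move=> ky; rewrite dvdn_mulr // dvdn_fact //=; lia. Qed.

Lemma modulus_gt1 k : k < y -> 1 < m k.
Proof.
move=> ky; rewrite /m -[1]addn0 ltn_add2l divn_gt0 //.
by apply: dvdn_leq (dvdn_modulus_base ky); rewrite muln_gt0 fact_gt0.
Qed.

Lemma modulus_prime k p : k < y -> prime p -> p %| m k -> Q < p.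
Proof.
move=> ky pp pm; rewrite ltnNge; apply/negP => pQ.
have : p %| N %/ k.+1.
  rewrite /N -muln_divA; last by rewrite dvdn_fact //=; lia.
  by rewrite dvdn_mulr // dvdn_fact // prime_gt0.
move=> pN; have : p %| 1 by rewrite -(dvdn_addl _ pN).
by rewrite dvdn1 => /eqP p1; rewrite p1 in pp.
Qed.

Lemma dvdn_modulus k d : k < y -> d %| m k -> d %| N + k.+1.
Proof.
move=> ky dm; have : d %| m k * k.+1 by rewrite dvdn_mulr.
by rewrite /m mulnDl mul1n divnK ?dvdn_modulus_base // addnC.
Qed.

Lemma modulus_coprime i j : i < y -> j < y -> i != j -> coprime (m i) (m j).
Proof.
move=> iy jy nij; apply: coprime_no_prime => // p pp pi pj.
have pQ := modulus_prime iy pp pi.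
have pd : p %| (i - j) + (j - i).
  have [ij|ji] := leqP i j.
    rewrite (eqP (ij : i - j == 0)) add0n -subSS -(subnDl N).
    by apply: dvdn_sub; apply: dvdn_modulus.
  rewrite (eqP (ltnW ji : j - i == 0)) addn0 -subSS -(subnDl N).
  by apply: dvdn_sub; apply: dvdn_modulus.
have ij0 : 0 < i - j + (j - i) by clear -nij; lia.
by have := dvdn_leq ij0 pd; clear -pQ yQ iy jy; lia.
Qed.

Lemma modulus_dvd_bin k : k < y -> m k %| 'C(N + y, y).
Proof.
move=> ky; rewrite (bin_prod_moduli dvdn_modulus_base).
by rewrite (bigD1 (Ordinal ky)) //= dvdn_mulr.
Qed.

(** Since (k + 1) [m k] = N + k + 1, N is -(k + 1) modulo d. A single c that is -(N + 1) modulo the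
    binomial coefficient thus represents every index k < y, each at its own modulus. *)
Lemma modulus_residue k c d : k < y -> d %| m k -> 'C(N + y, y) %| c + N.+1 ->
  c = k %[mod d].
Proof.
move=> ky dm Mc; apply/eqP; rewrite -(eqn_modDr N.+1).
have /eqP -> : d %| c + N.+1 := dvdn_trans (dvdn_trans dm (modulus_dvd_bin ky)) Mc.
by have /eqP := dvdn_modulus ky dm; rewrite addnS addnC -addnS => ->.
Qed.

End Moduli.

(** A prime dividing a(a - 1)...(a - u) divides some a - j. Divisibility thereby expresses a bound
    on residues. *)
Lemma prime_dvd_ffact p a u : prime p -> u < p -> p %| a ^_ u.+1 -> a %% p <= u.
Proof.
move=> pp up; have [au|ua] := leqP a u.
  by rewrite modn_small ?(leq_ltn_trans au).
rewrite ffact_prod Euclid_dvd_prod // big_orE => /existsP [j] /=.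
have ju : j <= u by rewrite -ltnS.
have ja : j <= a by rewrite (leq_trans ju) // ltnW.
by rewrite -eqn_mod_dvd // => /eqP ->; rewrite modn_small ?(leq_ltn_trans ju).
Qed.

Lemma dvd_ffact d a u x : x <= u -> a = x %[mod d] -> d %| a ^_ u.+1.
Proof.
move=> xu Ha; have [au|ua] := leqP a u; first by rewrite ffact_small.
rewrite ffact_prod (bigD1 (Ordinal (xu : x < u.+1))) //= dvdn_mulr //.
by rewrite -eqn_mod_dvd ?Ha // (leq_trans xu) // ltnW.
Qed.

(** Bounds both polynomials when all variables are at most u, by monotonicity; the last summand
    makes primes above this bound exceed u too. *)
Definition qbound L R u := peval (fun=> u) L + peval (fun=> u) R + u.

(** The witnesses for all i < y are packed by the Chinese remainder theorem: modulo the i-th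
    modulus, [a j] is the j-th witness for i, and c is i. Conversely, a prime factor p of the i-th
    modulus exceeds Q; the residues of the [a j] modulo p are at most u, so both polynomials take
    values below p, and being congruent they are equal. *)
Lemma bounded_forall_arith L R k y (e : nat -> nat) (n := maxn (pvars L) (pvars R)) :
  (forall i, i < y -> exists x, peval (mix k x (scons i e)) L = peval (mix k x (scons i e)) R)
  <-> exists u c a, [/\ y <= u, forall i, i < n -> e i <= u &
    let N := (qbound L R u)`! * (qbound L R u)`! in
    [/\ 'C(N + y, y) %| c + N.+1, forall i, i < k -> 'C(N + y, y) %| a i ^_ u.+1 &
      peval (mix k a (scons c e)) L = peval (mix k a (scons c e)) R %[mod 'C(N + y, y)]]].
Proof.
split=> [H|[u [c [a [yu eu /=]]]]].
  have [x Hx] : exists x : nat -> nat -> nat, forall i, i < y ->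
      peval (mix k (x i) (scons i e)) L = peval (mix k (x i) (scons i e)) R.
    have /choice [x Hx] : forall i, exists x, i < y ->
        peval (mix k x (scons i e)) L = peval (mix k x (scons i e)) R.
      move=> i; have [iy|yi] := ltnP i y; last by exists e.
      by have [x Hx] := H i iy; exists x.
    by exists x.
  pose u := y + \sum_(i < n) e i + \sum_(i < y) \sum_(j < k) x i j.
  pose Q := qbound L R u; pose N := Q`! * Q`!.
  have yu : y <= u by rewrite /u -addnA leq_addr.
  have yQ : y <= Q by rewrite (leq_trans yu) // leq_addl.
  have xu i j : i < y -> j < k -> x i j <= u.
    move=> iy jk; rewrite /u (bigD1 (Ordinal iy)) //= (bigD1 (Ordinal jk)) //=.
    by rewrite -!addnA; do 2 apply: (leq_trans _ (leq_addl _ _)); exact: leq_addr.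
  have eu i : i < n -> e i <= u.
    move=> lin; rewrite /u (bigD1 (Ordinal lin)) //=.
    by rewrite -!addnA; apply: (leq_trans _ (leq_addl _ _)); exact: leq_addr.
  have co := @modulus_coprime Q y yQ.
  have /choice [a Ha] : forall j, exists b, forall i, i < y -> b = x i j %[mod 1 + N %/ i.+1].
    by move=> j; exact: (chinese_seq (fun i => x i j) co).
  pose M := 'C(N + y, y).
  have ME : M = \prod_(i < y) (1 + N %/ i.+1).
    exact/bin_prod_moduli/dvdn_modulus_base.
  have Mdvd z : (forall i, i < y -> 1 + N %/ i.+1 %| z) -> M %| z.
    by rewrite ME; exact: dvdn_prod_coprime.
  have M0 : 0 < M by rewrite bin_gt0 leq_addl.
  (* This c is a natural number congruent to -(N + 1) modulo M. *)
  exists u, (M * N.+1 - N.+1), a; split=> //; split.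
  - by rewrite subnK ?dvdn_mulr // leq_pmull.
  - move=> j jk; apply: Mdvd => i iy; apply: dvd_ffact (xu i j iy jk) _; exact: Ha.
  apply/eqP; rewrite eqn_mod_dist; apply: Mdvd => i iy.
  rewrite -eqn_mod_dist; set d := 1 + _; set c := M * _ - _.
  have E j : mix k a (scons c e) j = mix k (x i) (scons i e) j %[mod d].
    rewrite /mix; case: ifP => [jk|_]; first exact: Ha.
    case: (j - k) => //=; apply: (modulus_residue yQ iy (dvdnn _)).
    by rewrite subnK ?dvdn_mulr // leq_pmull.
  by rewrite (peval_mod L E) (peval_mod R E) Hx.
set Q := qbound L R u; set N := Q`! * Q`! => -[Mc Ma MLR] i iy.
have yQ : y <= Q by rewrite (leq_trans yu) // leq_addl.
pose p := pdiv (1 + N %/ i.+1).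
have pp : prime p by apply: pdiv_prime; exact: (modulus_gt1 yQ iy).
have pm : p %| 1 + N %/ i.+1 := pdiv_dvd _.
have Qp : Q < p := modulus_prime yQ iy pp pm.
have pM : p %| 'C(N + y, y) := dvdn_trans pm (modulus_dvd_bin yQ iy).
have up : u < p by apply: leq_ltn_trans Qp; exact: leq_addl.
pose x j := a j %% p; exists x.
have E j : mix k x (scons i e) j = mix k a (scons c e) j %[mod p].
  rewrite /mix; case: ifP => [jk|_]; first exact: modn_mod.
  by case: (j - k) => //=; rewrite (modulus_residue yQ iy pm Mc).
have xu j : j < n -> mix k x (scons i e) j <= u.
  move=> jn; rewrite /mix; case: ifP => [jk|_].
    by apply: prime_dvd_ffact => //; exact: dvdn_trans pM (Ma _ jk).
  have : j - k < n by rewrite (leq_ltn_trans (leq_subr _ _)).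
  case: (j - k) => [_|l ln] /=; first by rewrite (leq_trans (ltnW iy)).
  by rewrite eu // ltnW.
have Lp : peval (mix k x (scons i e)) L < p.
  apply: leq_ltn_trans Qp; apply: (leq_trans (n := peval (fun=> u) L)).
    by apply: peval_le => j jL; apply: xu; rewrite leq_max jL.
  by rewrite /Q /qbound -addnA leq_addr.
have Rp : peval (mix k x (scons i e)) R < p.
  apply: leq_ltn_trans Qp; apply: (leq_trans (n := peval (fun=> u) R)).
    by apply: peval_le => j jL; apply: xu; rewrite leq_max jL orbT.
  by rewrite /Q /qbound addnAC leq_addl.
rewrite -(modn_small Lp) -(modn_small Rp) (peval_mod L E) (peval_mod R E).
by rewrite -(modn_dvdm _ pM) MLR modn_dvdm.
Qed.

Lemma diof_peval p r : diof (fun e => peval (fun i => e (r i)) p).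
Proof.
by elim: p => [i|n|p IHp q IHq|p IHp q IHq] /=; dio_tac.
Qed.

Lemma dio_true : dio (fun=> True).
Proof. by apply: (dio_ext (P := fun=> 0 = 0)) => //; dio_tac. Qed.

Lemma dio_all_lt n (P : nat -> (nat -> nat) -> Prop) :
  (forall i, dio (P i)) -> dio (fun e => forall i, i < n -> P i e).
Proof.
move=> dP; elim: n => [|n IH]; first by apply: (dio_ext (P := fun=> True)); last exact: dio_true.
apply: (dio_ext (P := fun e => P n e /\ forall i, i < n -> P i e)); last exact: dio_and.
move=> e; split=> [[Pn H] i|H]; last by split=> [|i Hi]; apply: H => //; rewrite ltnW.
by rewrite ltnS leq_eqVlt => /orP[/eqP->|/H].
Qed.

Lemma dio_forall_lt (P : nat -> (nat -> nat) -> Prop) F :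
  dio (fun e => P (e 0) (fun i => e i.+1)) -> diof F ->
  dio (fun e => forall i, i < F e -> P i e).
Proof.
move=> [k [B [[L [R HLR]] HB]]] dF; set n := maxn (pvars L) (pvars R).
(* A sequence w lists the k numbers a, then c, then u, then the parameters; [rho] skips u, which the
   polynomials do not see. As k and n depend only on the polynomials, quantifiers over i < k and i <
   n are finite conjunctions. *)
pose sh (w : nat -> nat) i := w (k + i.+2).
pose u (w : nat -> nat) := w (k + 1); pose c (w : nat -> nat) := w (k + 0).
pose N w := (qbound L R (u w))`! * (qbound L R (u w))`!.
pose M w := 'C(N w + F (sh w), F (sh w)).
pose rho i := if i < k then i else if i == k then k else i.+1.
pose body w := [/\ F (sh w) <= u w, forall i, i < n -> sh w i <= u w &
  [/\ M w %| c w + (N w).+1, forall i, i < k -> M w %| w i ^_ (u w).+1 &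
    peval (fun i => w (rho i)) L %% M w = peval (fun i => w (rho i)) R %% M w]].
have dsh : diof (fun w => F (sh w)) by exact: (@diof_rename F (fun i => k + i.+2)).
have dbody : dio body.
  have dN : diof N.
    rewrite /N /qbound /u; have := diof_peval L (fun=> k + 1).
    by have := diof_peval R (fun=> k + 1) => dR dL; dio_tac.
  have dM : diof M by rewrite /M; dio_tac.
  rewrite /body /u /c; dio_tac.
  - by apply: dio_all_lt => i; rewrite /sh; dio_tac.
  - by apply: dio_all_lt => i; dio_tac.
  - exact: diof_peval.
  - exact: diof_peval.
apply: (dio_ext (P := fun e => exists u c a, body (mix k a (scons c (scons u e))))).
  move=> e.
  have E w d a : sh (mix k a (scons d (scons w e))) = e /\
      (fun i => mix k a (scons d (scons w e)) (rho i)) = mix k a (scons d e).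
    split; apply/funext => i; rewrite /sh /mix /rho; first by rewrite ltnNge leq_addr /= addKn.
    case: (ltngtP i k) => [->//|ki|->]; last by rewrite ltnn subnn.
    by rewrite ltnNge (ltnW (leqW ki)) /= subSn ?(ltnW ki) // -(subnSK ki).
  have Eu w d a : u (mix k a (scons d (scons w e))) = w.
    by rewrite /u /mix ltnNge leq_addr /= addKn.
  have Ec w d a : c (mix k a (scons d (scons w e))) = d.
    by rewrite /c /mix ltnNge leq_addr /= addKn.
  have Ea w d a i : i < k -> mix k a (scons d (scons w e)) i = a i.
    by rewrite /mix => ->.
  have EP i : P i e <-> exists x, peval (mix k x (scons i e)) L = peval (mix k x (scons i e)) R.
    rewrite (HB (scons i e) : P i e <-> _).
    by split=> -[x Hx]; exists x; apply/HLR.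
  transitivity (forall i, i < F e -> exists x,
      peval (mix k x (scons i e)) L = peval (mix k x (scons i e)) R); last first.
    by split=> H i iF; apply/EP; exact: H.
  rewrite bounded_forall_arith; split=> -[w [d [a]]].
    rewrite /body /M /N !(E w d a).1 (E w d a).2 Eu Ec => -[H1 H2 [H3 H4 H5]].
    by exists w, d, a; split=> //; split=> // i ik; rewrite -(Ea w d a) //; exact: H4.
  move=> [H1 H2 [H3 H4 H5]]; exists w, d, a.
  rewrite /body /M /N !(E w d a).1 (E w d a).2 Eu Ec.
  by split=> //; split=> // i ik; rewrite Ea //; exact: H4.
apply: dio_ex; apply: dio_ex.
have dm := dio_mix k dbody.
apply: (dio_ext (P := fun e => exists a, body (mix k a e))) => // e.
suff -> : scons (e 0) (scons (e 1) (fun i => e i.+2)) = e by [].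
by apply/funext => -[|[|i]].
Qed.
End BoundedQuantifier.

(** * Recursive functions *)

Section RecursiveFunctions.
Local Open Scope nat_scope.

Lemma diof_ext F G : (forall e, F e = G e) -> diof F -> diof G.
Proof. by move=> FG; apply: dio_ext => e; rewrite FG. Qed.

Lemma diof_comp m (f : m.-tuple nat -> nat) (G : nat -> (nat -> nat) -> nat) :
  diof (fun e => f [tuple e i | i < m]) -> (forall i, diof (G i)) ->
  diof (fun e => f [tuple G i e | i < m]).
Proof.
move=> df dG.
pose P (w : nat -> nat) := (forall i, i < m -> w i = G i (fun j => w (m + j.+1))) /\
  w (m + 0) = f [tuple w i | i < m].
have dP : dio P.
  apply: dio_and.
    by apply: dio_all_lt => i; apply: dio_eq; [exact: diof_var | exact: diof_rename].
  apply: (@dio_rename (fun w => w 0 = f [tuple w i.+1 | i < m])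
     (fun i => if i is j.+1 then j else m + 0)); exact: df.
change (dio (fun e => e 0 = f [tuple G i (fun j => e j.+1) | i < m])).
apply: dio_ext (dio_mix m dP) => e.
have E a : (forall i : 'I_m, mix m a e i = a i) /\ forall j, mix m a e (m + j) = e j.
  by split=> [i|j]; rewrite /mix ?ltn_ord // ltnNge leq_addr /= addKn.
have ET a : [tuple mix m a e i | i < m] = [tuple a i | i < m].
  by apply: eq_from_tnth => i; rewrite !tnth_mktuple (E a).1.
have Esh a : (fun j => mix m a e (m + j.+1)) = (fun j => e j.+1).
  by apply/funext => j; rewrite (E a).2.
split=> [[a []]|H].
  rewrite Esh (E a).2 ET => Ha ->; congr f; apply: eq_from_tnth => i.
  by rewrite !tnth_mktuple -(Ha i (ltn_ord i)) (E a).1.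
pose a i := G i (fun j => e j.+1); exists a; split.
  by move=> i im; rewrite Esh -[i]/(nat_of_ord (Ordinal im)) (E a).1.
by rewrite (E a).2 ET.
Qed.

Lemma mktuple_scons T n (a : T) (e : nat -> T) :
  [tuple scons a e i | i < n.+1] = [tuple of a :: [tuple e i | i < n]].
Proof.
apply: eq_from_tnth => i; rewrite tnth_mktuple.
by case: (unliftP ord0 i) => [j ->|->]; rewrite ?tnth0 ?tnthS ?tnth_mktuple.
Qed.

(** One beta pair codes the whole run of values up to k, and a bounded quantifier checks each
    step. *)
Lemma prim_rec_beta n (f : n.-tuple nat -> nat) (g : n.+2.-tuple nat -> nat)
    (h : n.+1.-tuple nat -> nat) k (v : n.-tuple nat) y :
  (forall v : n.-tuple nat, h [tuple of 0%N :: v] = f v) ->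
  (forall k (v : n.-tuple nat), h [tuple of k.+1 :: v] =
       g [tuple of k :: h [tuple of k :: v] :: v]) ->
  y = h [tuple of k :: v] <-> exists u w, [/\ f v = beta u w 0, y = beta u w k &
    forall i, i < k -> beta u w i.+1 = g [tuple of i :: beta u w i :: v]].
Proof.
move=> h0 hS; split=> [->|[u [w [Ef -> Eg]]]].
  have [u [w Huw]] := beta_seq k.+1 (fun i => h [tuple of i :: v]).
  exists u, w; split; rewrite ?Huw ?h0 // => i ik.
  by rewrite !Huw ?hS // ltnW.
suff H i : i <= k -> beta u w i = h [tuple of i :: v] by exact: H.
elim: i => [|i IH] ik; first by rewrite h0.
by rewrite Eg // IH ?hS // ltnW.
Qed.

Lemma recursive_dio n (f : n.-tuple nat -> nat) :
  recursive f -> diof (fun e => f [tuple e i | i < n]).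
Proof.
elim=> {n f} [||n i|m n f g _ IHf _ IHg|n f g h _ IHf _ IHg h0 hS|n f g _ IHf Hg].
- exact: diof_const.
- apply: (diof_ext (F := fun e => (e 0).+1)); last by apply/diof_succ/diof_var.
  by move=> e; rewrite /thead tnth_mktuple.
- apply: (diof_ext (F := fun e => e i)); last exact: diof_var.
  by move=> e; rewrite tnth_mktuple.
(* [diof_comp] expects a family over all natural numbers; indices from m on get the dummy 0. *)
- pose G i e := if insub i is Some j then g j [tuple e i | i < n] else 0.
  have dG i : diof (G i) by rewrite /G; case: insub => [j|]; [exact: IHg | exact: diof_const].
  apply: (diof_ext (F := fun e => f [tuple G i e | i < m])); last exact: (diof_comp IHf dG).
  move=> e; congr f; apply: eq_from_tnth => i.
  by rewrite !tnth_mktuple /G valK.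
- apply: (dio_ext (P := fun e => exists u w,
      [/\ f [tuple e i.+2 | i < n] = beta u w 0, e 0 = beta u w (e 1) &
      forall i, i < e 1 -> beta u w i.+1 =
         g [tuple scons i (scons (beta u w i) (fun l => e l.+2)) j | j < n.+2]])).
    move=> e; have -> : [tuple e i.+1 | i < n.+1] = [tuple of e 1 :: [tuple e i.+2 | i < n]].
      rewrite -(@mktuple_scons nat n (e 1) (fun i => e i.+2)); apply: eq_from_tnth => i; rewrite !tnth_mktuple.
      by case: (i : nat).
    rewrite (prim_rec_beta (e 1) _ (e 0) h0 hS).
    have E i b : [tuple scons i (scons b (fun j => e j.+2)) j | j < n.+2] =
       [tuple of i :: b :: [tuple e i.+2 | i < n]].
      have Eb := @mktuple_scons nat n b (fun j => e j.+2).
      by rewrite mktuple_scons Eb.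
    by split=> -[u [w [H1 H2 H3]]]; exists u, w; split=> // i ik; rewrite H3 // E.
  dio_tac.
  + exact: (@diof_rename _ (fun i => i.+4) IHf).
  apply: (@dio_forall_lt _ (fun e => e 3)); last by dio_tac.
  apply: dio_eq; first by dio_tac.
  apply: (@diof_comp _ g (fun j e => scons (e 0) (scons (beta (e 2) (e 1) (e 0))
     (fun j => e j.+4.+1)) j)) => //.
  by case=> [|[|j]] /=; dio_tac.
change (dio (fun e => e 0 = g [tuple e i.+1 | i < n])).
apply: (dio_ext (P := fun e => f [tuple e i | i < n.+1] = 0 /\
   forall k, k < e 0 -> f [tuple scons k (fun j => e j.+1) i | i < n.+1] <> 0)).
  move=> e; have -> : [tuple e i | i < n.+1] = [tuple of e 0 :: [tuple e i.+1 | i < n]].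
    rewrite -(@mktuple_scons nat n (e 0) (fun i => e i.+1)); apply: eq_from_tnth => i; rewrite !tnth_mktuple.
    by case: (i : nat).
  set v := [tuple e i.+1 | i < n]; have [Hg0 Hg1] := Hg v.
  split=> [[H0 H1]|->]; last by split=> // i; rewrite mktuple_scons; exact: Hg1.
  case: (ltngtP (e 0) (g v)) => // [/Hg1//|/H1].
  by rewrite mktuple_scons Hg0.
apply: dio_and; first by apply: dio_eq; [exact: IHf | exact: diof_const].
apply: (@dio_forall_lt (fun k e => f [tuple scons k (fun j => e j.+1) i | i < n.+1] <> 0)
    (fun e => e 0)); last exact: diof_var.
apply: dio_neq; last exact: diof_const.
apply: (@diof_comp _ f (fun i e => scons (e 0) (fun j => e j.+2) i)) => //.
by case=> [|j] /=; dio_tac.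
Qed.

Lemma diof_recursive1 (f : 1.-tuple nat -> nat) F :
  recursive f -> diof F -> diof (fun e => f [tuple F e]).
Proof.
move=> rf dF; apply: (diof_ext (F := fun e => f [tuple F e | i < 1])).
  by move=> e; congr f; apply: eq_from_tnth => i; rewrite tnth_mktuple (ord1 i).
exact: (@diof_comp 1 f (fun=> F) (recursive_dio rf)).
Qed.
End RecursiveFunctions.

(** * Nonnegative integers among the integers *)

Section FourSquares.
Local Open Scope ring_scope.

Definition sum4 (n : int) := exists a b c d : int, n = a * a + b * b + c * c + d * d.

Lemma sum4_ge0 n : sum4 n -> 0 <= n.
Proof. by move=> [a [b [c [d ->]]]]; rewrite !addr_ge0 // -expr2 sqr_ge0. Qed.

(** Euler's identity, the multiplicativity of the quaternion norm. *)
Lemma sum4M m n : sum4 m -> sum4 n -> sum4 (m * n).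
Proof.
move=> [a [b [c [d ->]]]] [x [y [z [w ->]]]].
exists (a * x + b * y + c * z + d * w), (a * y - b * x + c * w - d * z),
  (a * z - b * w - c * x + d * y), (a * w + b * z - c * y - d * x).
lia.
Qed.

(** Pigeonhole for odd p: the (p + 1)/2 residues a^2 are distinct, and so are the (p + 1)/2 residues
    -1 - b^2, written p^2 - 1 - b^2, so the two families meet. The bound on a and b keeps m below
    p. *)
Lemma prime_dvd_sum_squares p : prime p -> exists a b m : nat,
  [/\ (p * m = a * a + b * b + 1)%N, (0 < m)%N & (m < p)%N].
Proof.
move=> pp; have p1 := prime_gt1 pp.
have [->|p2] := eqVneq p 2; first by exists 1%N, 0%N, 1%N.
have odd_p : odd p by case/even_prime: pp p2 => [->|].
pose q := p./2.+1; have pq : (p + 1 = 2 * q)%N by rewrite /q; lia.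
pose f (x : 'I_q + 'I_q) : 'I_p := match x with
  | inl a => Ordinal (ltn_pmod (a * a) (ltnW p1))
  | inr b => Ordinal (ltn_pmod (p * p - 1 - b * b) (ltnW p1)) end.
have /injectivePn [x [y nxy fxy]] : ~~ injectiveb f.
  apply/negP => /injectiveP /leq_card; rewrite card_sum !card_ord; lia.
have sqr_inj (a b : 'I_q) : (a * a = b * b %[mod p])%N -> a = b.
  have lt (a' b' : 'I_q) : (a' < b')%N -> (a' * a' = b' * b' %[mod p])%N -> False.
    move=> ab /eqP; rewrite eq_sym eqn_mod_dvd; last by rewrite leq_mul // ltnW.
    have -> : (b' * b' - a' * a' = (b' - a') * (b' + a'))%N by rewrite !mulnn subn_sqr.
    rewrite Euclid_dvdM // => /orP[] /dvdn_leq H; have := ltn_ord b'; have := ltn_ord a';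
      have := H (_ : (0 < _)%N); lia.
  move=> H; apply/val_inj; case: (ltngtP a b) => // [/lt|/lt]; [move/(_ H) | move/(_ (esym H))]; by [].
have bb (b : 'I_q) : (b * b + 1 < p * p)%N.
  have : (b * b <= (q - 1) * (q - 1))%N by rewrite leq_mul //; have := ltn_ord b; lia.
  have [k [-> ->]] : exists k, (q - 1 = k.+1 /\ p = 2 * k + 3)%N by exists (q - 2)%N; lia.
  nia.
have mixed (a b : 'I_q) : (a * a = p * p - 1 - b * b %[mod p])%N -> exists a b m : nat,
  [/\ (p * m = a * a + b * b + 1)%N, (0 < m)%N & (m < p)%N].
  move=> H; have /dvdnP [m Em] : (p %| a * a + b * b + 1)%N.
    have : (a * a + (b * b + 1) == p * p - 1 - b * b + (b * b + 1) %[mod p])%N.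
      by rewrite eqn_modDr; apply/eqP.
    have -> : (p * p - 1 - b * b + (b * b + 1) = p * p)%N by have := bb b; lia.
    by rewrite modnMl addnA => /eqP/eqP.
  exists a, b, m; split; [by lia | by case: (m) Em => //; lia |].
  rewrite -(ltn_pmul2r (ltnW p1)) -Em.
  have : (a * a <= (q - 1) * (q - 1))%N by rewrite leq_mul //; have := ltn_ord a; lia.
  have : (b * b <= (q - 1) * (q - 1))%N by rewrite leq_mul //; have := ltn_ord b; lia.
  have [k [-> ->]] : exists k, (q - 1 = k.+1 /\ p = 2 * k + 3)%N by exists (q - 2)%N; lia.
  nia.
case: x y nxy fxy => [a|b] [a'|b'] nxy /(congr1 val) /= H.
- by case/eqP: nxy; rewrite (sqr_inj a a').
- exact: mixed H.
- exact: mixed (esym H).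
case/eqP: nxy; rewrite (sqr_inj b b') //; apply/eqP.
have := bb b; have := bb b' => Hb' Hb.
have : (p * p - 1 - b * b + (b * b + b' * b') == p * p - 1 - b' * b' + (b * b + b' * b') %[mod p])%N.
  by rewrite eqn_modDr; apply/eqP.
have -> : (p * p - 1 - b * b + (b * b + b' * b') = p * p - 1 + b' * b')%N by lia.
have -> : (p * p - 1 - b' * b' + (b * b + b' * b') = p * p - 1 + b * b)%N by lia.
by rewrite eqn_modDl eq_sym.
Qed.

(* Allowing a multiplier replaces the descent in the proof of Lagrange's
   theorem by a plain induction. *)
Lemma nat_sum4_multiple (n : nat) : exists N, [/\ N <> 0, sum4 N & sum4 (Posz n * N)].
Proof.
have s0 : sum4 0 by exists 0, 0, 0, 0.
have s1 : sum4 1 by exists 1, 0, 0, 0.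
elim/ltn_ind: n => n IH.
case: (ltnP 1 n) => [n1|]; last by case: n IH => [|[|n]] // _ _; exists 1.
have [np|/primePn] := boolP (prime n).
  (* Since nm is a sum of squares and m < n, a multiplier N for m yields the multiplier mN for n:
     n(mN) = (nm)N. *)
  have [a [b [m [E m0 mn]]]] := prime_dvd_sum_squares np.
  have [N [N0 sN sS]] := IH m mn.
  have N1 := sum4_ge0 sN.
  exists (Posz m * N); split=> //; first by nia.
  rewrite mulrA -PoszM E; apply: sum4M => //.
  by exists (Posz a), (Posz b), 1, 0; lia.
case=> [|[d /andP[d1 dn] /dvdnP [k Ek]]]; first by rewrite ltnNge n1.
have [N1 [N10 sN1 sS1]] := IH d dn.
have kn : (k < n)%N by nia.
have [N2 [N20 sN2 sS2]] := IH k kn.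
exists (N2 * N1); split; [by nia | exact: sum4M |].
by rewrite Ek PoszM mulrACA; exact: sum4M.
Qed.

(** Neither factor on the right can vanish. Conversely, z is 2^a times an odd number, and w = 2^a
    works because 4^a is 1 modulo 3. *)
Lemma nonzero_intP (z : int) :
  z <> 0 <-> exists w s t, z * w = (2 * s + 1) * (3 * t + 1).
Proof.
split=> [z0|[w [s [t E]]] z0]; last first.
  have [//|] : 2 * s + 1 = 0 \/ 3 * t + 1 = 0; try lia.
  by move: E; rewrite z0 mul0r => /esym/eqP; rewrite mulf_eq0 => /orP[]/eqP; [left|right].
have [a [s E]] : exists (a : nat) s, z = 2 ^+ a * (2 * s + 1).
  have [N] : exists N : nat, (`|z| <= N)%N by exists `|z|%N.
  elim: N z z0 => [|N IH] z z0 zN; first by lia.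
  have [[y Ey]|[y Ey]] : (exists y, z = 2 * y) \/ (exists y, z = 2 * y + 1).
  - have [?|?] : (z %% 2)%Z = 0 \/ (z %% 2)%Z = 1 by lia.
      by left; exists (z %/ 2)%Z; lia.
    by right; exists (z %/ 2)%Z; lia.
  - have [||a [s E]] := IH y; try lia.
    by exists a.+1, s; rewrite exprS Ey E mulrA.
  by exists 0%N, y; rewrite expr0 mul1r.
have [t Et] : exists t, 2 ^+ a * 2 ^+ a = 3 * t + 1 :> int.
  elim: (a) => [|b [t Et]]; first by exists 0; rewrite expr0.
  by exists (4 * t + 1); rewrite !exprS; lia.
by exists (2 ^+ a), s, t; rewrite -Et E; lia.
Qed.

Lemma int_ge0P (n : int) : 0 <= n <-> exists N, [/\ N <> 0, sum4 N & sum4 (n * N)].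
Proof.
split=> [n0|[N [N0 /sum4_ge0 s1 /sum4_ge0 s2]]]; last by nia.
by have := nat_sum4_multiple `|n|%N; rewrite gez0_abs.
Qed.
End FourSquares.

(** * Exponent-sums *)

Section Words.
Local Open Scope group_scope.
Variables (L : Type) (G : groupType).
Implicit Types (f : L -> G) (w : word L).

Lemma eval_nil f : eval f [::] = 1.
Proof. by rewrite /eval big_nil. Qed.

Lemma eval_cons f a w :
  eval f (a :: w) = (if a.2 then (f a.1)^-1 else f a.1) * eval f w.
Proof. by rewrite /eval big_cons. Qed.

Lemma eval_cat f w1 w2 : eval f (w1 ++ w2) = eval f w1 * eval f w2.
Proof. by rewrite /eval big_cat. Qed.

Lemma eval_nseq f l n : eval f (nseq n (l, false)) = f l ^+ n.
Proof. by elim: n => [|n IH]; rewrite ?eval_nil // eval_cons IH expgS. Qed.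

Definition word_inv w : word L := rev [seq (a.1, ~~ a.2) | a <- w].

Lemma eval_inv f w : eval f (word_inv w) = (eval f w)^-1.
Proof.
elim: w => [|a w IH]; first by rewrite eval_nil invg1.
rewrite /word_inv /= rev_cons -cats1 eval_cat IH !eval_cons eval_nil mulg1 invgM /=.
by case: a.2; rewrite ?invgK.
Qed.
End Words.

Section ExponentSumMorphism.
Local Open Scope group_scope.
Variables (G : groupType) (S : set G).
Hypothesis genS : gen S = setT.
Implicit Types (s g h x y : G) (w : word G) (a b : G * bool).

Definition Sword (w : word G) := forall a, a \in w -> S a.1.

Definition inverse_letters (a b : G * bool) := (a.1 == b.1) && (a.2 != b.2).

Definition push (a : G * bool) (w : word G) : word G :=
  if w is b :: w' then if inverse_letters a b then w' else a :: w else [:: a].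

Lemma free_words_push a w : S a.1 -> free_words S w -> free_words S (push a w).
Proof.
case: w => [|b w] Sa [Sw sw] /=.
  by split=> // c; rewrite inE => /eqP->.
case: ifPn => [ab|nab].
  split=> [c cw|]; first by apply: Sw; rewrite inE cw orbT.
  exact: path_sorted sw.
split=> [c|]; first by rewrite inE => /orP[/eqP->|/Sw].
by rewrite /= nab.
Qed.

Lemma proj_push a w : proj (push a w) = proj (a :: w).
Proof.
case: w => [|b w] //=; case: ifP => // /andP[/eqP E1 E2].
rewrite /proj !eval_cons mulgA -[LHS]mul1g; congr (_ * _).
by rewrite E1; move: E2; case: a.2; case: b.2 => // _; rewrite ?mulVg ?mulgV.
Qed.

Lemma word_expsum_cons s a w : word_expsum s (a :: w) =
  ((if a.1 == s then if a.2 then -1 else 1 else 0) + word_expsum s w)%R.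
Proof. by rewrite /word_expsum big_cons; case: ifP => // _; rewrite add0r. Qed.

Lemma word_expsum_push s a w : word_expsum s (push a w) = word_expsum s (a :: w).
Proof.
case: w => [|b w] //=; case: ifP => // /andP[/eqP E1 E2].
rewrite !word_expsum_cons E1; case: ifP => _; last by rewrite !add0r.
by rewrite addrA; move: E2; case: a.2; case: b.2 => // _; rewrite add0r.
Qed.

(** Exponent-sums are defined by freely reduced words, whereas products are concatenations.
    Prepending letters with [push], which cancels inverse pairs, changes neither value nor
    exponents. *)
Lemma reduced_word w : Sword w ->
  exists w', [/\ free_words S w', proj w' = proj w &
                 forall s, word_expsum s w' = word_expsum s w].
Proof.
elim: w => [|a w IH] Sw; first by exists [::].
have [|w' [fw pw ew]] := IH; first by move=> b bw; apply: Sw; rewrite inE bw orbT.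
exists (push a w'); split.
- by apply: free_words_push => //; apply: Sw; rewrite inE eqxx.
- by rewrite proj_push /proj !eval_cons -/(proj w') pw.
- by move=> s; rewrite word_expsum_push !word_expsum_cons ew.
Qed.

Lemma Sword_cat w1 w2 : Sword w1 -> Sword w2 -> Sword (w1 ++ w2).
Proof. by move=> H1 H2 a; rewrite mem_cat => /orP[/H1|/H2]. Qed.

Lemma Sword_exists g : exists2 w, Sword w & proj w = g.
Proof.
have : gen S g by rewrite genS.
move=> /(_ [set g | exists2 w, Sword w & proj w = g]%classic); apply; split=> [|x Sx]; last first.
  exists [:: (x, false)]; first by move=> a; rewrite inE => /eqP->.
  by rewrite /proj eval_cons eval_nil mulg1.
split=> [|x y [w1 S1 E1] [w2 S2 E2]].
  by exists [::]; rewrite // /proj eval_nil.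
exists (w1 ++ word_inv w2).
  apply: Sword_cat => // a; rewrite /word_inv mem_rev => /mapP [b /S2 Sb ->]; exact: Sb.
by rewrite /proj eval_cat eval_inv -/(proj w1) -/(proj w2) E1 E2.
Qed.

Section WellDefined.
Variable s : G.
Hypothesis wd : expsum_well_defined S s.

(** Under [wd] every freely reduced word for an element is minimal, so the choice made by [xget]
    does not matter. *)
Lemma expsum_word w : Sword w -> expsum S s (proj w) = word_expsum s w.
Proof.
move=> Sw; have [w' [fw pw ew]] := reduced_word Sw.
rewrite /expsum; case: xgetP => [n _ [v [fv pv _] <-]|H].
  by rewrite -ew; apply: wd => //; rewrite pv pw.
case: (H (word_expsum s w')); exists w' => //; split=> // v fv pv.
by rewrite (wd fw fv) // pw pv.
Qed.

Lemma word_expsum_cat w1 w2 : word_expsum s (w1 ++ w2) = (word_expsum s w1 + word_expsum s w2)%R.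
Proof. by rewrite /word_expsum big_cat. Qed.

Lemma expsumM x y : expsum S s (x * y) = (expsum S s x + expsum S s y)%R.
Proof.
have [w1 S1 <-] := Sword_exists x; have [w2 S2 <-] := Sword_exists y.
have -> : proj w1 * proj w2 = proj (w1 ++ w2) by rewrite /proj eval_cat.
by rewrite !expsum_word ?word_expsum_cat //; exact: Sword_cat.
Qed.

Lemma expsum_letter x : S x -> expsum S s x = if x == s then 1%R else 0%R.
Proof.
move=> Sx; have E : proj [:: (x, false)] = x by rewrite /proj eval_cons eval_nil mulg1.
have Sw : Sword [:: (x, false)] by move=> a; rewrite inE => /eqP->.
by rewrite -{1}E expsum_word // word_expsum_cons /word_expsum big_nil addr0.
Qed.

Lemma expsum1 : expsum S s 1 = 0%R.
Proof. by have := expsumM 1 1; rewrite mulg1; lia. Qed.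

Lemma expsumV x : expsum S s x^-1 = (- expsum S s x)%R.
Proof. by have := expsumM x x^-1; rewrite mulgV expsum1; lia. Qed.

Lemma expsumX x n : expsum S s (x ^+ n) = (Posz n * expsum S s x)%R.
Proof.
elim: n => [|n IH]; first by rewrite expg0 expsum1 mul0r.
by rewrite expgS expsumM IH; lia.
Qed.

Lemma expsum_expz x t : expsum S s (expz x t) = (t * expsum S s x)%R.
Proof. by case: t => n; rewrite /expz ?expsumV expsumX // NegzE; lia. Qed.

End WellDefined.

Lemma conj_powersE s1 s2 g h x :
    expsum_well_defined S s1 -> expsum_well_defined S s2 ->
    S s1 -> S s2 -> s1 <> s2 ->
  conj_powers S s1 s2 g h x <->
  expsum S s2 x = (expsum S s1 x * expsum S s2 g)%R.
Proof.
move=> wd1 wd2 S1 S2 neq.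
have e11 : expsum S s1 s1 = 1%R by rewrite expsum_letter // eqxx.
have e22 : expsum S s2 s2 = 1%R by rewrite expsum_letter // eqxx.
have e12 : expsum S s1 s2 = 0%R by rewrite expsum_letter //; case: eqP => // /esym.
have e21 : expsum S s2 s1 = 0%R by rewrite expsum_letter //; case: eqP.
split=> [[t [k [[k1 k2] ->]]]|E].
  rewrite !(expsumM wd1) !(expsumM wd2) !(expsumV wd1) !(expsumV wd2).
  rewrite !(expsum_expz wd1) !(expsum_expz wd2) !(expsumM wd1) !(expsumM wd2).
  rewrite !(expsum_expz wd1) !(expsum_expz wd2) e11 e12 e21 e22.
  by move: k1 k2; rewrite /expsum_ker /= => -> ->; lia.
(* By [E], p has both exponents of x; conjugation by h preserves them, so the cofactor lies in
   K_{s1,s2}. *)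
pose p := expz (s1 * expz s2 (expsum S s2 g)) (expsum S s1 x).
exists (expsum S s1 x), (p^-1 * (h * x * h^-1)); split; last first.
  by rewrite -/p mulVKg !mulgA mulVg mul1g -mulgA mulVg mulg1.
by split; rewrite /expsum_ker /= ?(expsumM wd1) ?(expsumM wd2) ?(expsumV wd1) ?(expsumV wd2)
  /p ?(expsum_expz wd1) ?(expsum_expz wd2) ?(expsumM wd1) ?(expsumM wd2)
  ?(expsum_expz wd1) ?(expsum_expz wd2) ?e11 ?e12 ?e21 ?e22; lia.
Qed.
End ExponentSumMorphism.

(** * Instances of DP(G, ab) *)

Section TermEvaluation.
Local Open Scope group_scope.
Variables (V C : Type) (G : groupType) (nu : V -> G) (c : C -> G).

Lemma teval_nil : teval nu c [::] = 1.
Proof. exact: eval_nil. Qed.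

Lemma teval_cons a w : teval nu c (a :: w) =
  (let x := match a.1 with inl v => nu v | inr k => c k end in
   if a.2 then x^-1 else x) * teval nu c w.
Proof. exact: eval_cons. Qed.
End TermEvaluation.

Section Instances.
Local Open Scope group_scope.
Variables (G : groupType) (r : nat) (c : r.-tuple G).
Implicit Types (e nu : nat -> G) (I J : DP_instance r).

Definition dp_holds nu I : Prop :=
  (forall w, w \in I.1 -> teval nu (tnth c) w = 1) /\
  (forall w, w \in I.2 -> teval (fun v => ab (nu v)) (fun i => ab (tnth c i)) w = 1).

Definition dp_base (P : (nat -> G) -> Prop) :=
  exists Is : seq (DP_instance r), forall e, P e <-> exists I, I \in Is /\ dp_holds e I.

Lemma dp_holds_cat nu I J :
  dp_holds nu (I.1 ++ J.1, I.2 ++ J.2) <-> dp_holds nu I /\ dp_holds nu J.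
Proof.
split=> [[H1 H2]|[[I1 I2] [J1 J2]]].
  by split; split=> w Hw; [apply: H1 | apply: H2 | apply: H1 | apply: H2];
    rewrite mem_cat Hw ?orbT.
by split=> w; rewrite mem_cat => /orP[]; [exact: I1 | exact: J1 | exact: I2 | exact: J2].
Qed.

Lemma dp_base_and P Q : dp_base P -> dp_base Q -> dp_base (fun e => P e /\ Q e).
Proof.
move=> [Is HI] [Js HJ].
exists [seq ((i.1 ++ j.1, i.2 ++ j.2) : DP_instance r) | i <- Is, j <- Js] => e; rewrite HI HJ.
split=> [[[I [iI hI]] [J [jJ hJ]]]|[K [/allpairsP [[I J] [/= iI jJ ->]] /dp_holds_cat [hI hJ]]]].
  exists (I.1 ++ J.1, I.2 ++ J.2); rewrite dp_holds_cat; split=> //.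
  by apply/allpairsP; exists (I, J).
by split; [exists I | exists J].
Qed.

Definition rename_word (rho : nat -> nat) (w : term nat 'I_r) : term nat 'I_r :=
  [seq (match a.1 with inl v => inl (rho v) | inr k => inr k end, a.2) | a <- w].

Lemma teval_rename (H : groupType) (nu : nat -> H) (d : 'I_r -> H) rho w :
  teval nu d (rename_word rho w) = teval (nu \o rho) d w.
Proof.
by elim: w => [|[[v|k] b] w IH]; rewrite ?teval_nil //= !teval_cons IH.
Qed.

Definition rename_instance rho I : DP_instance r :=
  (map (rename_word rho) I.1, map (rename_word rho) I.2).

Lemma dp_holds_rename nu rho I :
  dp_holds nu (rename_instance rho I) <-> dp_holds (nu \o rho) I.
Proof.
split=> -[H1 H2]; split=> w.
- by move=> Hw; rewrite -teval_rename; apply: H1; exact: map_f.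
- by move=> Hw; have := H2 _ (map_f (rename_word rho) Hw); rewrite teval_rename.
- by case/mapP => w' Hw' ->; rewrite teval_rename; exact: H1.
by case/mapP => w' Hw' ->; rewrite teval_rename; exact: H2.
Qed.

Lemma dp_base_rename P (rho : nat -> nat) : dp_base P -> dp_base (fun e => P (e \o rho)).
Proof.
move=> [Is HI]; exists (map (rename_instance rho) Is) => e; rewrite HI.
split=> [[I [iI hI]]|[J [/mapP [I iI ->] /dp_holds_rename hI]]]; last by exists I.
by exists (rename_instance rho I); rewrite dp_holds_rename map_f.
Qed.

Lemma teval_ab nu w :
  teval (fun v => ab (nu v)) (fun i => ab (tnth c i)) w = ab (teval nu (tnth c) w).
Proof.
have abV x : ab x^-1 = (ab x)^-1 :> abelianisation G by rewrite -ab_invE.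
elim: w => [|[[v|k] b] w IH]; first by rewrite !teval_nil.
  by rewrite !teval_cons IH abM /=; case: b; rewrite ?abV.
by rewrite !teval_cons IH abM /=; case: b; rewrite ?abV.
Qed.

Lemma dp_base_word (w : term nat 'I_r) : dp_base (fun e => teval e (tnth c) w = 1).
Proof.
exists [:: ([:: w], [::])] => e; split=> [H|[I []]].
  by exists ([:: w], [::]); rewrite mem_head; split=> //; split=> // w'; rewrite inE => /eqP->.
by rewrite inE => /eqP-> [H _]; apply: H; rewrite mem_head.
Qed.

(** * From systems with constants in G to instances over named constants *)

Section Translation.
Variables (C : seq G) (idx : G -> 'I_r).
Hypothesis idxP : forall g, g \in C -> tnth c (idx g) = g.

Definition term_over (V : Type) (w : term V G) :=
  all (fun a => if a.1 is inr g then g \in C else true) w.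

Definition system_over (V : eqType) (E : system G V) :=
  all (@term_over V) E.1 && all (fun p => term_over p.1 && term_over p.2) E.2.

Definition translate_word (V : Type) (phi : V -> nat) (w : term V G) : term nat 'I_r :=
  [seq (match a.1 with inl v => inl (phi v) | inr g => inr (idx g) end, a.2) | a <- w].

Lemma teval_translate (V : Type) (phi : V -> nat) nu (w : term V G) : term_over w ->
  teval nu (tnth c) (translate_word phi w) = teval (nu \o phi) id w.
Proof.
elim: w => [|[[v|g] b] w IH] /= => [_|/IH E|/andP[gC /IH E]]; first by rewrite !teval_nil.
  by rewrite !teval_cons E.
by rewrite !teval_cons E /= idxP.
Qed.

Definition instance_of (V : eqType) (phi : V -> nat) (E : system G V) : DP_instance r :=
  (map (translate_word phi) E.1,
   [seq translate_word phi p.1 ++ word_inv (translate_word phi p.2) | p <- E.2]).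

Lemma dp_holds_instance (V : eqType) (phi : V -> nat) (E : system G V) nu : system_over E ->
  dp_holds nu (instance_of phi E) <-> solves (nu \o phi) E.
Proof.
move=> /andP[/allP o1 /allP o2].
have Ep p : p \in E.2 ->
    teval nu (tnth c) (translate_word phi p.1 ++ word_inv (translate_word phi p.2)) =
    teval (nu \o phi) id p.1 * (teval (nu \o phi) id p.2)^-1.
  move=> /o2 /andP[? ?]; rewrite -!teval_translate // /teval eval_cat eval_inv //.
have abE x y : ab (x * y^-1) = 1 :> abelianisation G <-> ab x = ab y.
  rewrite abM -[ab y^-1]ab_invE; split=> [H|->]; last exact: mulgV.
  by rewrite -[ab x]mulg1 -(mulVg (ab y)) mulgA H mul1g.
split=> -[H1 H2]; split.
- by move=> w Hw; rewrite -teval_translate ?o1 //; apply: H1; exact: map_f.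
- move=> p Hp; apply/abE; rewrite -Ep // -teval_ab; apply: H2.
  exact: (map_f (fun p => translate_word phi p.1 ++ word_inv (translate_word phi p.2))).
- by move=> _ /mapP [w Hw ->]; rewrite teval_translate ?o1 //; exact: H1.
by move=> _ /mapP [p Hp ->]; rewrite teval_ab Ep //; apply/abE; exact: H2.
Qed.

Lemma dp_base_systems (V : eqType) (phi : V -> nat) (Es : seq (system G V)) :
  all (@system_over V) Es -> dp_base (fun e => exists E, E \in Es /\ solves (e \o phi) E).
Proof.
move=> /allP oE; exists (map (instance_of phi) Es) => e.
split=> [[E [EE sE]]|[_ [/mapP [E EE ->] /dp_holds_instance sE]]].
  by exists (instance_of phi E); rewrite map_f // dp_holds_instance // oE.
by exists E; split=> //; apply: sE; exact: oE.
Qed.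

Definition gdef := pos_ex dp_base.

Lemma gdef_PE m k (Es : seq (system G ('I_m + 'I_k)%type)) (D : set (m.-tuple G)) :
  all (@system_over _) Es -> PE_defines Es D -> gdef (fun e => D [tuple e i | i < m]).
Proof.
move=> oE HD; pose phi (v : 'I_m + 'I_k) := match v with inl i => (k + i)%N | inr j => j : nat end.
exists k, (fun e => exists E, E \in Es /\ solves (e \o phi) E); split.
  exact: dp_base_systems.
move=> e; rewrite HD; split=> [[E [EE [y sE]]]|[x [E [EE sE]]]].
  exists (fun i => nth 1 y i), E; split=> //.
  suff -> : mix k (fun i => nth 1 y i) e \o phi = valuation [tuple e i | i < m] y by [].
  apply/funext => -[i|j]; rewrite /mix /phi /=.
    by rewrite ltnNge leq_addr /= addKn tnth_mktuple.
  by rewrite ltn_ord -tnth_nth.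
exists E; split=> //; exists [tuple x i | i < k].
suff -> : valuation [tuple e i | i < m] [tuple x i | i < k] = mix k x e \o phi by [].
apply/funext => -[i|j]; rewrite /mix /phi /= tnth_mktuple ?ltn_ord //.
by rewrite ltnNge leq_addr /= addKn.
Qed.

Lemma teval_subst (V : Type) (nu : V -> G) g (w : term (option V) G) :
  teval nu id (subst_term g w) = teval (fun v => if v is Some v' then nu v' else g) id w.
Proof.
by elim: w => [|[[[v|]|h] b] w IH]; rewrite ?teval_nil //= !teval_cons IH.
Qed.

Lemma solves_subst (V : eqType) (nu : V -> G) g (E : system G (option V)) :
  solves nu (subst_system g E) <-> solves (fun v => if v is Some v' then nu v' else g) E.
Proof.
split=> -[H1 H2]; split.
- by move=> w Hw; rewrite -teval_subst; apply: H1; exact: map_f.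
- move=> p Hp; rewrite -!teval_subst.
  exact: (H2 _ (map_f (fun p => (subst_term g p.1, subst_term g p.2)) Hp)).
- by move=> _ /mapP [w Hw ->]; rewrite teval_subst; exact: H1.
by move=> _ /mapP [p Hp ->] /=; rewrite !teval_subst; exact: H2.
Qed.

(** The same systems serve every g, so z can be read as a further variable. Nothing is claimed about
    Q where z lies outside [Z]. *)
Lemma gdef_PE_family n (Es : seq (system G (option ('I_1 + 'I_n)%type)))
    (D : G -> set (1.-tuple G)) (Z : set G) :
  all (@system_over _) Es -> (forall g, Z g -> PE_defines [seq subst_system g E | E <- Es] (D g)) ->
  exists Q, gdef Q /\ forall e, Z (e 0) -> Q e <-> D (e 0) [tuple e 1%N].
Proof.
move=> oE HD.
pose phi (v : option ('I_1 + 'I_n)) :=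
  match v with None => n | Some (inl i) => n.+1 | Some (inr j) => j : nat end.
pose B e := exists E, E \in Es /\ solves (e \o phi) E.
exists (fun e => exists x, B (mix n x e)); split.
  exists n, B; split=> //; exact: dp_base_systems.
move=> e Ze; rewrite (HD _ Ze).
have Ephi (y : n.-tuple G) (x : nat -> G) : (forall j : 'I_n, tnth y j = x j) ->
    (fun v => if v is Some v' then valuation [tuple e 1%N] y v' else e 0) = mix n x e \o phi.
  move=> yx; apply/funext => -[[i|j]|]; rewrite /mix /phi /=.
  - by rewrite ltnNge leqnSn /= subSnn (ord1 i).
  - by rewrite ltn_ord.
  - by rewrite ltnn subnn.
split=> [[x [E [EE sE]]]|[_ [/mapP [E EE ->] [y /solves_subst sE]]]].
  exists (subst_system (e 0) E); split; first exact: map_f.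
  exists [tuple x i | i < n]; apply/solves_subst; rewrite (Ephi _ x) // => j.
  by rewrite tnth_mktuple.
exists (fun i => nth 1 y i), E; split=> //; rewrite -(Ephi y) // => j.
exact: tnth_nth.
Qed.

End Translation.
End Instances.

(** * Integers represented by group elements through an exponent-sum *)

Section IntegerDefinability.
Local Open Scope ring_scope.
Variables (G : groupType) (r : nat) (c : r.-tuple G) (s : G) (idx : 'I_r) (ex : G -> int).
Hypotheses (exM : forall x y, ex (x * y)%g = ex x + ex y) (ex_s : ex s = 1).
Hypothesis idxE : tnth c idx = s.

Let base := dp_base c.
Definition zdef := definable ex base.
Definition zdeff := definable_fun ex base.

Hypothesis zdef_eq0 : zdef (fun z => z 0%N = z 1%N).
Hypothesis zdef_mul0 : zdef (fun z => z 0%N = z 1%N * z 2%N).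

Implicit Types (P Q R : (nat -> int) -> Prop) (F H : (nat -> int) -> int).

Lemma ex1 : ex 1%g = 0.
Proof. by have := exM 1%g 1%g; rewrite mulg1; lia. Qed.

Lemma exX n : ex (s ^+ n)%g = Posz n.
Proof.
elim: n => [|n IH]; first by rewrite expg0 ex1.
by rewrite expgS exM IH ex_s; lia.
Qed.

Lemma ex_expz : cancel (expz s) ex.
Proof.
case=> n; first exact: exX.
by have := exM (s ^- n.+1)%g (s ^+ n.+1)%g; rewrite mulVg ex1 exX /expz NegzE; lia.
Qed.

Let dp_and := @dp_base_and G r c.
Let dp_rename := @dp_base_rename G r c.

Lemma zdef_ext P Q : (forall e, P e <-> Q e) -> zdef P -> zdef Q.
Proof. exact: definable_ext. Qed.

Lemma zdef_and P Q : zdef P -> zdef Q -> zdef (fun e => P e /\ Q e).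
Proof. exact: (definable_and dp_and dp_rename). Qed.

Lemma zdef_and3 P Q R : zdef P -> zdef Q -> zdef R -> zdef (fun e => [/\ P e, Q e & R e]).
Proof.
move=> dP dQ dR; apply: (zdef_ext (P := fun e => P e /\ Q e /\ R e)).
  by move=> e; split=> [[? []]|[]].
by do !apply: zdef_and.
Qed.

Lemma zdef_ex (P : int -> (nat -> int) -> Prop) :
  zdef (fun e => P (e 0%N) (fun i => e i.+1)) -> zdef (fun e => exists b, P b e).
Proof. exact: (definable_ex ex_expz). Qed.

Lemma zdef_mix k P : zdef P -> zdef (fun e => exists a, P (mix k a e)).
Proof. exact: (definable_mix ex_expz). Qed.

Lemma zdef_eq F H : zdeff F -> zdeff H -> zdef (fun e => F e = H e).
Proof. exact: (definable_eq ex_expz dp_and dp_rename zdef_eq0). Qed.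

Lemma zdeff_var i : zdeff (fun e => e i).
Proof. exact: (definable_fun_var dp_rename zdef_eq0 i). Qed.

(** A word equation constrains a group element, while an integer fixes its representative only up to
    the kernel of [ex]. So the word produces an auxiliary x, and e 0 is compared with x through
    [ex]. *)
Lemma zdef_word (w : term nat 'I_r) P :
  (forall e x, teval (scons x e) (tnth c) w = 1%g -> P (ex \o e) <-> ex (e 0%N) = ex x) ->
  (forall e, exists x, teval (scons x e) (tnth c) w = 1%g) -> zdef P.
Proof.
move=> HP Hw; apply: (pos_ex_ext (P := fun e => exists x,
    teval (scons x e) (tnth c) w = 1%g /\ ex (e 0%N) = ex x)).
  move=> e; split=> [[x [wx /(HP _ _ wx)]]|Pe] //.
  by have [x wx] := Hw e; exists x; split=> //; apply/(HP _ _ wx).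
apply: pos_ex_ex; apply: (pos_ex_and dp_and dp_rename).
  apply: (pos_ex_ext (P := fun e => teval e (tnth c) w = 1%g)).
    by move=> e; have -> : scons (e 0%N) (fun i => e i.+1) = e by apply/funext => -[].
  exact/pos_ex_base/dp_base_word.
exact: (@definable_rename _ _ ex _ dp_rename (fun e => e 0%N = e 1%N) (fun i => (1 - i)%N) zdef_eq0).
Qed.

Lemma zdeff_const (n : nat) : zdeff (fun=> Posz n).
Proof.
have E e x : teval (scons x e) (tnth c) ((inl 0%N, true) :: nseq n (inr idx, false)) = 1%g <->
    x = (s ^+ n)%g.
  rewrite teval_cons /teval eval_nseq /= idxE.
  by split=> [H|->]; rewrite ?mulVg // -[x]mulg1 -H mulVKg.
apply: (@zdef_word ((inl 0%N, true) :: nseq n (inr idx, false)) (fun z => z 0%N = Posz n)).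
  by move=> e x /E ->; rewrite exX.
by move=> e; exists (s ^+ n)%g; apply/E.
Qed.

Lemma zdeff_add F H : zdeff F -> zdeff H -> zdeff (fun e => F e + H e).
Proof.
apply: (definable_op2 ex_expz dp_and dp_rename zdef_eq0 (op := fun x y => x + y)).
have E e x : teval (scons x e) (tnth c) [:: (inl 0, true); (inl 2, false); (inl 3, false)]%N = 1%g <->
    x = (e 1%N * e 2%N)%g.
  rewrite !teval_cons teval_nil /= mulg1.
  by split=> [H'|->]; rewrite ?mulVg // -[x]mulg1 -H' mulVKg.
apply: (@zdef_word [:: (inl 0, true); (inl 2, false); (inl 3, false)]%N
  (fun z => z 0%N = z 1%N + z 2%N)).
  by move=> e x /E -> /=; rewrite exM.
by move=> e; exists (e 1%N * e 2%N)%g; apply/E.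
Qed.

Lemma zdeff_mul F H : zdeff F -> zdeff H -> zdeff (fun e => F e * H e).
Proof. exact: (definable_op2 ex_expz dp_and dp_rename zdef_eq0 (op := fun x y => x * y)). Qed.

Ltac zdef_tac :=
  lazymatch goal with
  | |- zdef (fun e => exists _, _) => apply zdef_ex; cbn beta; zdef_tac
  | |- zdef (fun e => _ /\ _) => apply zdef_and; zdef_tac
  | |- zdef (fun e => [/\ _, _ & _]) => apply zdef_and3; zdef_tac
  | |- zdef (fun e => _ = _) => apply zdef_eq; zdef_tac
  | |- zdeff (fun e => e _) => apply zdeff_var
  | |- zdeff (fun e => _ + _) => apply zdeff_add; zdef_tac
  | |- zdeff (fun e => _ * _) => apply zdeff_mul; zdef_tac
  | |- zdeff (fun=> _) => first [apply (zdeff_const 1) | apply (zdeff_const 2) | apply (zdeff_const 3)]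
  end.

Lemma zdef_ge0 : zdef (fun z => 0 <= z 0%N).
Proof.
apply: (zdef_ext (P := fun z => exists N,
   [/\ exists w s t, N * w = (2 * s + 1) * (3 * t + 1),
       exists a b c d, N = a * a + b * b + c * c + d * d &
       exists a b c d, z 0%N * N = a * a + b * b + c * c + d * d])).
  by move=> z; rewrite int_ge0P; split=> -[N [/nonzero_intP N0 sN sS]]; exists N.
by zdef_tac.
Qed.

Lemma zdef_all_lt n (P : nat -> (nat -> int) -> Prop) :
  (forall i, zdef (P i)) -> zdef (fun e => forall i, (i < n)%N -> P i e).
Proof.
move=> dP; elim: n => [|n IH].
  by apply: (zdef_ext (P := fun z => z 0%N = z 0%N)) => //; zdef_tac.
apply: (zdef_ext (P := fun e => P n e /\ forall i, (i < n)%N -> P i e)); last exact: zdef_and.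
move=> e; split=> [[Pn H] i|H]; last by split=> [|i Hi]; apply: H => //; rewrite ltnW.
by rewrite ltnS leq_eqVlt => /orP[/eqP->|/H].
Qed.

Fixpoint zeval (z : nat -> int) p :=
  match p with
  | PVar i => z i
  | PConst n => Posz n
  | PAdd p q => zeval z p + zeval z q
  | PMul p q => zeval z p * zeval z q
  end.

Lemma zeval_Posz e p : zeval (Posz \o e) p = Posz (peval e p).
Proof. by elim: p => //= p -> q ->; rewrite ?PoszD ?PoszM. Qed.

Lemma zdeff_zeval p : zdeff (fun z => zeval z p).
Proof.
elim: p => [i|n|p IHp q IHq|p IHp q IHq] /=; first exact: zdeff_var.
- exact: zdeff_const.
- exact: zdeff_add.
exact: zdeff_mul.
Qed.

(** The bound variables are restricted to nonnegative integers; the free ones are required to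
    represent natural numbers, at every place. *)
Lemma gdef_dio (P : (nat -> nat) -> Prop) : dio P ->
  exists Q : (nat -> G) -> Prop, gdef c Q /\
    forall e e', (forall i, ex (e i) = Posz (e' i)) -> Q e <-> P e'.
Proof.
move=> [k [B [[L [T HLR]] HB]]].
pose W w := (forall i, (i < k)%N -> 0 <= w i) /\ zeval w L = zeval w T.
have dW : zdef W.
  apply: zdef_and; last by apply: zdef_eq; exact: zdeff_zeval.
  apply: (zdef_all_lt k (P := fun i w => 0 <= w i)) => i.
  exact: (@definable_rename _ _ ex _ dp_rename (fun z => 0 <= z 0%N) (fun=> i) zdef_ge0).
exists (fun e => exists x, W (mix k x (ex \o e))); split; first exact: zdef_mix.
move=> e e' Ee; rewrite (HB e').
have -> : ex \o e = Posz \o e' by apply/funext => i; exact: Ee.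
have E x : mix k (Posz \o x) (Posz \o e') = Posz \o mix k x e'.
  by apply/funext => i; rewrite /mix /=; case: ifP.
split=> [[x [x0 H]]|[x /HLR H]].
  exists (fun i => `|x i|%N); apply/HLR/eqP; rewrite -eqz_nat -!zeval_Posz -E.
  suff -> : mix k (Posz \o (fun i => `|x i|%N)) (Posz \o e') = mix k x (Posz \o e') by apply/eqP.
  apply/funext => i; rewrite /mix; case: ifP => // ik /=.
  by rewrite gez0_abs //; have := x0 i ik; rewrite /mix ik.
by exists (Posz \o x); rewrite /W E !zeval_Posz; split=> //; congr Posz.
Qed.
End IntegerDefinability.

(** * The diagonal argument *)

Section Codes.
Local Open Scope nat_scope.

Lemma code_cons n s : CodeSeq.code (n :: s) = 2 ^ n * (2 * CodeSeq.code s + 1).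
Proof. by rewrite mul2n addn1. Qed.

Lemma pickle_cons (T : countType) (x : T) s :
  pickle (x :: s) = 2 ^ pickle x * (2 * pickle s + 1).
Proof. exact: code_cons. Qed.

Lemma pickle_pair (T1 T2 : countType) (x : T1) (y : T2) :
  pickle (x, y) = 2 ^ pickle x * (2 * 2 ^ pickle y + 1).
Proof.
have -> : pickle (x, y) = CodeSeq.code [:: pickle x; pickle y] by [].
by rewrite !code_cons [CodeSeq.code [::]]/= muln0 add0n muln1.
Qed.

(** A geometric sum with ratio 2^{b+1}. The closed form makes the code of a power of a letter a
    Diophantine function of n. *)
Lemma code_nseq b n :
  CodeSeq.code (nseq n b) = 2 ^ b * (2 ^ (b.+1 * n) - 1) %/ (2 ^ b.+1 - 1).
Proof.
have B0 : 0 < 2 ^ b.+1 - 1 by rewrite subn_gt0 -{1}(expn0 2) ltn_exp2l.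
suff <- : CodeSeq.code (nseq n b) * (2 ^ b.+1 - 1) = 2 ^ b * (2 ^ (b.+1 * n) - 1).
  by rewrite mulnK.
elim: n => [|n IH]; first by rewrite muln0 expn0 subnn muln0.
have -> : nseq n.+1 b = b :: nseq n b by [].
rewrite code_cons mulnS expnD.
have : 0 < 2 ^ (b.+1 * n) by rewrite expn_gt0.
move: IH B0; rewrite expnS; move: (2 ^ b) (2 ^ (b.+1 * n)) (CodeSeq.code _) => B X C.
case: X => // X IH B0 _; have E1 : X.+1 - 1 = X by lia.
have [D ED] : exists D, 2 * B - 1 = D by eexists.
rewrite ED E1 in IH B0 *; have EB : 2 * B = D + 1 by lia.
have -> : 2 * B * X.+1 - 1 = 2 * B * X + D by rewrite mulnS; lia.
rewrite EB; nia.
Qed.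

(* The equation [X_i = s^n], where [idx] names [s]. *)
Definition numeral_word r (idx : 'I_r) (i n : nat) : term nat 'I_r :=
  (inl i, true) :: nseq n (inr idx, false).

Definition numeral_code (a b n : nat) :=
  2 ^ a * (2 * (2 ^ b * (2 ^ (b.+1 * n) - 1) %/ (2 ^ b.+1 - 1)) + 1).

Lemma pickle_numeral r (idx : 'I_r) i n : pickle (numeral_word idx i n) =
  numeral_code (pickle (inl i : nat + 'I_r, true)) (pickle (inr idx : nat + 'I_r, false)) n.
Proof.
rewrite pickle_cons /numeral_code; congr (_ * (2 * _ + 1)).
set l := (inr idx, false).
have -> : pickle (nseq n l) = CodeSeq.code (map pickle (nseq n l)) by [].
by rewrite map_nseq code_nseq.
Qed.

Lemma diof_numeral_code a b F : diof F -> diof (fun e => numeral_code a b (F e)).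
Proof. by move=> dF; rewrite /numeral_code; dio_tac. Qed.

(** The code of an instance with three numeral equations put in front, where x and y are the codes
    of its two components. *)
Definition diagonal_code (a0 a1 a2 b u v w x y : nat) :=
  2 ^ (2 ^ numeral_code a0 b u * (2 * (2 ^ numeral_code a1 b v *
        (2 * (2 ^ numeral_code a2 b w * (2 * x + 1)) + 1)) + 1)) * (2 * 2 ^ y + 1).

Lemma diof_diagonal_code a0 a1 a2 b : diof (fun e => diagonal_code a0 a1 a2 b (e 1) (e 2) (e 3)
  (beta (e 1) (e 2) (2 * e 0)) (beta (e 1) (e 2) (2 * e 0 + 1))).
Proof.
have dn a k : diof (fun e => numeral_code a b (e k)) by exact/diof_numeral_code/diof_var.
have := dn a2 3; have := dn a1 2; have := dn a0 1 => d0 d1 d2.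
by rewrite /diagonal_code; dio_tac.
Qed.

End Codes.

Section Diagonal.
Local Open Scope nat_scope.
Variables (G : groupType) (r : nat) (c : r.-tuple G) (s : G) (idx : 'I_r) (ex : G -> int).
Hypotheses (exM : forall x y, ex (x * y)%g = (ex x + ex y)%R) (ex_s : ex s = 1%R).
Hypothesis idxE : tnth c idx = s.
Hypothesis zdef_eq0 : zdef c ex (fun z => z 0 = z 1).
Hypothesis zdef_mul0 : zdef c ex (fun z => z 0 = (z 1 * z 2)%R).

Definition with_numerals (u v w : nat) (I : DP_instance r) : DP_instance r :=
  (numeral_word idx 0 u :: numeral_word idx 1 v :: numeral_word idx 2 w :: I.1, I.2).

Lemma dp_holds_numerals nu u v w I : dp_holds c nu (with_numerals u v w I) <->
  [/\ nu 0 = (s ^+ u)%g, nu 1 = (s ^+ v)%g, nu 2 = (s ^+ w)%g & dp_holds c nu I].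
Proof.
have E i n : teval nu (tnth c) (numeral_word idx i n) = 1%g <-> nu i = (s ^+ n)%g.
  rewrite teval_cons /teval eval_nseq /= idxE.
  by split=> [H|->]; rewrite ?mulVg // -[nu i]mulg1 -H mulVKg.
split=> [[H1 H2]|[/E H1 /E H2 /E H3 [H4 H5]]].
  split; try (apply/E; apply: H1; rewrite !inE eqxx ?orbT //).
  by split=> // t Ht; apply: H1; rewrite !inE Ht !orbT.
split=> // t; rewrite !inE => /orP[/eqP->|/orP[/eqP->|/orP[/eqP->|/H4]]] //.
Qed.

Lemma dio_instances (A : nat -> nat -> nat -> Prop) :
  dio (fun e => A (e 0) (e 1) (e 2)) ->
  exists Is : seq (DP_instance r), forall u v w,
    A u v w <-> exists I, I \in Is /\ DP_solvable c (with_numerals u v w I).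
Proof.
move=> /(gdef_dio exM ex_s idxE zdef_eq0 zdef_mul0) [Q [dQ HQ]].
(* [HQ] wants a natural number at every place, so the places from 3 on are identified with place 0;
   [rho] then puts the free variables at 0, 1, 2 and the bound ones from 3 on. *)
pose r3 i := if i < 3 then i else 0.
have [k [B [[Is HIs] HB]]] := pos_ex_rename (@dp_base_rename G r c) r3 dQ.
pose rho i := if i < k then i.+3 else r3 (i - k).
exists (map (rename_instance rho) Is) => u v w.
pose e' i := nth w [:: u; v] (r3 i).
have -> : A u v w <-> A (e' 0) (e' 1) (e' 2) by [].
split=> [HA|[_ [/mapP [I Iin ->] [nu /dp_holds_numerals [E0 E1 E2 /dp_holds_rename hI]]]]].
  pose e i := (s ^+ e' i)%g.
  have Ee i : ex (e i) = Posz (e' i) by exact: exX.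
  have Ee' : e' \o r3 = e' by apply/funext => -[|[|[|i]]].
  have /HB [x /HIs [I [Iin hI]]] : Q (fun i => e (r3 i)).
    by apply/(HQ _ (e' \o r3)) => [i|]; [exact: Ee | rewrite Ee'].
  exists (rename_instance rho I); split; first exact: map_f.
  pose nu i := if i < 3 then e i else x (i - 3).
  exists nu; apply/dp_holds_numerals; split=> //; apply/dp_holds_rename.
  have Er : (fun i => e (r3 i)) = e by apply/funext => -[|[|[|i]]].
  suff -> : nu \o rho = mix k x e by [].
  rewrite -{1}Er.
  apply/funext => i; rewrite /nu /rho /mix /=; case: (i < k); first by rewrite !subSS subn0.
  by rewrite (_ : r3 (i - k) < 3) // /r3; case: ifP.
pose e i := nu (r3 i).
have Ee i : ex (e i) = Posz (e' i).
  by rewrite /e /e'; case: i => [|[|[|i]]] /=; rewrite ?E0 ?E1 ?E2 exX.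
have Q3 : Q (fun i => e (r3 i)).
  apply/HB; exists (fun i => nu i.+3); apply/HIs; exists I; split=> //.
  suff -> : mix k (fun i => nu i.+3) e = nu \o rho by [].
  by apply/funext => i; rewrite /mix /rho /=; case: ifP.
suff : A (e' 0) (e' 1) (e' 2) by [].
by apply/(HQ (fun i => e (r3 i)) (e' \o r3)) => // i; exact: Ee.
Qed.

Lemma dp_undecidable : DP_undecidable G.
Proof.
move=> /(_ r c) [f [rf Hf]].
pose a i := pickle (inl i : nat + 'I_r, true); pose b := pickle (inr idx : nat + 'I_r, false).
pose code := diagonal_code (a 0) (a 1) (a 2) b.
have pickleE u v w I : pickle (with_numerals u v w I) = code u v w (pickle I.1) (pickle I.2).
  rewrite pickle_pair (pickle_cons (numeral_word idx 0 u)) (pickle_cons (numeral_word idx 1 v)).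
  by rewrite (pickle_cons (numeral_word idx 2 w)) !pickle_numeral.
pose A u v w := forall j, j < w ->
  f [tuple code u v w (beta u v (2 * j)) (beta u v (2 * j + 1))] = 0.
have dA : dio (fun e => A (e 0) (e 1) (e 2)).
  rewrite /A; apply: (@dio_forall_lt (fun j e =>
    f [tuple code (e 0) (e 1) (e 2) (beta (e 0) (e 1) (2 * j)) (beta (e 0) (e 1) (2 * j + 1))] = 0)
    (fun e => e 2)); last exact: diof_var.
  apply: dio_eq; last exact: diof_const.
  apply: (diof_recursive1 rf (F := fun e => code (e 1) (e 2) (e 3)
    (beta (e 1) (e 2) (2 * e 0)) (beta (e 1) (e 2) (2 * e 0 + 1)))).
  exact: diof_diagonal_code.
have [Is HIs] := dio_instances dA.
pose I0 : DP_instance r := ([::], [::]).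
(* The two components of the j-th instance are stored at places 2j and 2j + 1, because
   [diagonal_code] takes them separately. *)
have [u [v Huv]] := beta_seq (2 * size Is) (fun n =>
   if odd n then pickle (nth I0 Is n./2).2 else pickle (nth I0 Is n./2).1).
have codeE j : j < size Is ->
    code u v (size Is) (beta u v (2 * j)) (beta u v (2 * j + 1)) =
    pickle (with_numerals u v (size Is) (nth I0 Is j)).
  move=> js; rewrite pickleE !Huv; try lia.
  by rewrite addn1 mul2n /= odd_double /= uphalf_double doubleK.
have nA : A u v (size Is) <-> ~ A u v (size Is).
  split=> [HA|nA].
    rewrite HIs => -[I [/(nthP I0) [j js <-] sI]].
    have [/(_ sI) H _] := Hf (with_numerals u v (size Is) (nth I0 Is j)).
    by have := HA j js; rewrite codeE // H.
  move=> j js; rewrite codeE //; apply: (Hf _).2 => sI; apply: nA.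
  by apply/HIs; exists (nth I0 Is j); rewrite mem_nth.
tauto.
Qed.
End Diagonal.

(** * Collecting the constants of finitely many systems *)

Section Constants.
Local Open Scope group_scope.
Variable G : groupType.

Lemma all_over_exists (T : Type) (P : seq G -> pred T) :
  (forall C C' x, {subset C <= C'} -> P C x -> P C' x) -> (forall x, exists C, P C x) ->
  forall s, exists C, all (P C) s.
Proof.
move=> mono exP; elim=> [|x s [C1 H1]]; first by exists [::].
have [C2 H2] := exP x; exists (C1 ++ C2) => /=.
rewrite (mono C2) //=; last by move=> g gC; rewrite mem_cat gC orbT.
by apply: sub_all H1 => y; apply: mono => g gC; rewrite mem_cat gC.
Qed.

Lemma term_over_sub (V : Type) (C C' : seq G) (w : term V G) :
  {subset C <= C'} -> term_over C w -> term_over C' w.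
Proof. by move=> CC'; apply: sub_all => -[[v|g] b] //=; exact: CC'. Qed.

Lemma term_over_exists (V : Type) (w : term V G) : exists C, term_over C w.
Proof.
elim: w => [|[[v|g] b] w [C H]]; [by exists [::] | by exists C |].
exists (g :: C); rewrite /= mem_head; apply: term_over_sub H => h hC.
by rewrite inE hC orbT.
Qed.

Lemma system_over_sub (V : eqType) (C C' : seq G) (E : system G V) :
  {subset C <= C'} -> system_over C E -> system_over C' E.
Proof.
move=> CC' /andP[H1 H2]; apply/andP; split.
  by apply: sub_all H1 => w; exact: term_over_sub.
by apply: sub_all H2 => p /andP[? ?]; rewrite !(term_over_sub CC').
Qed.

Lemma systems_over_exists (V : eqType) (Es : seq (system G V)) :
  exists C, all (@system_over G C V) Es.
Proof.
apply: all_over_exists => [C C' E|E]; first exact: system_over_sub.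
have [C1 H1] := all_over_exists (fun C C' w => @term_over_sub V C C' w) (@term_over_exists V) E.1.
have [C2 H2] : exists C, all (fun p => term_over C p.1 && term_over C p.2) E.2.
  apply: (all_over_exists (P := fun C (p : term V G * term V G) =>
    term_over C p.1 && term_over C p.2)) => [C C' p sCC' /andP[? ?]|p].
    by rewrite !(term_over_sub sCC').
  have [C3 H3] := term_over_exists p.1; have [C4 H4] := term_over_exists p.2.
  exists (C3 ++ C4); rewrite (term_over_sub _ H3) ?(term_over_sub _ H4) // => g gC;
    by rewrite mem_cat gC ?orbT.
exists (C1 ++ C2); apply/andP; split.
  by apply: sub_all H1 => w; apply: term_over_sub => g gC; rewrite mem_cat gC.
by apply: sub_all H2 => p /andP[H3 H4]; rewrite (term_over_sub _ H3) ?(term_over_sub _ H4) // => g gC;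
  rewrite mem_cat gC orbT.
Qed.
End Constants.

(** * Multiplication from condition (2), and undecidability *)

Local Open Scope classical_set_scope.
Local Open Scope group_scope.

Theorem lemma5p3 (G : groupType) (S : set G) (s1 s2 : G)
    (genS : gen S = setT)
    (S_s1 : S s1) (S_s2 : S s2)
    (prim_s1 : abelian_primitive s1) (prim_s2 : abelian_primitive s2)
    (neq_s12 : s1 <> s2)
    (wd_s1 : expsum_well_defined S s1) (wd_s2 : expsum_well_defined S s2)
    (cond1 : [/\ PE_definable_rel (fun g h => expsum S s1 g = expsum S s1 h),
                 PE_definable_rel (fun g h => expsum S s2 g = expsum S s2 h) &
                 PE_definable_rel (fun g h => expsum S s1 g = expsum S s2 h)])
    (cond2 : exists n (Sigma : seq (system G (option ('I_1 + 'I_n)%type))),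
       forall g, expsum_ker S s1 g -> exists hg : G,
         PE_defines [seq subst_system g E | E <- Sigma]
           [set x : 1.-tuple G | conj_powers S s1 s2 g hg (thead x)]) :
  DP_undecidable G.
Proof.
have [[k1 [Es1 PE1]] _ [k3 [Es3 PE3]]] := cond1.
have [n [Sigma PE2]] := cond2.
have [C1 over1] := systems_over_exists Es1.
have [C3 over3] := systems_over_exists Es3.
have [C2 over2] := systems_over_exists Sigma.
(* [s1] is added because the numerals are words in it. *)
pose C := s1 :: C1 ++ C2 ++ C3.
have [sub1 sub2 sub3] : [/\ {subset C1 <= C}, {subset C2 <= C} & {subset C3 <= C}].
  by split=> g gC; rewrite !inE !mem_cat gC !orbT.
pose c := in_tuple C; pose i0 : 'I_(size C) := ord0.
have i0E : tnth c i0 = s1 by [].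
pose idx g : 'I_(size C) := inord (index g C).
have idxP g : g \in C -> tnth c (idx g) = g.
  move=> gC; have lt : (index g C < size C)%N by rewrite index_mem.
  by rewrite (tnth_nth s1) inordK // nth_index.
pose e1 := expsum S s1; pose e2 := expsum S s2.
have e1M x y : e1 (x * y) = (e1 x + e1 y)%R by exact: expsumM.
have e2M x y : e2 (x * y) = (e2 x + e2 y)%R by exact: expsumM.
have [e11 e22] : e1 s1 = 1%R /\ e2 s2 = 1%R by rewrite /e1 /e2 !expsum_letter ?eqxx.
have [e12 e21] : e1 s2 = 0%R /\ e2 s1 = 0%R.
  by rewrite /e1 /e2 !expsum_letter //; split; case: eqP => // /esym.
have dR1 : zdef c e1 (fun z => z 0%N = z 1%N).
  have := gdef_PE idxP (sub_all (fun E => @system_over_sub _ _ _ _ E sub1) over1) PE1.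
  by apply: pos_ex_ext => e /=; rewrite !tnth_mktuple.
have dR12 : gdef c (fun e => e1 (e 0%N) = e2 (e 1%N)).
  have := gdef_PE idxP (sub_all (fun E => @system_over_sub _ _ _ _ E sub3) over3) PE3.
  by apply: pos_ex_ext => e /=; rewrite !tnth_mktuple.
pose D g := [set x : 1.-tuple G | e2 (thead x) = (e1 (thead x) * e2 g)%R].
have PED g : expsum_ker S s1 g -> PE_defines [seq subst_system g E | E <- Sigma] (D g).
  move=> /PE2 [h Hh] a; rewrite -Hh; apply: iff_sym.
  exact: conj_powersE.
have [Q [dQ HQ]] := gdef_PE_family idxP (sub_all (fun E => @system_over_sub _ _ _ _ E sub2) over2) PED.
have and_ := @dp_base_and G (size C) c; have rn := @dp_base_rename G (size C) c.
have dmul : zdef c e1 (fun z => z 0%N = (z 1%N * z 2%N)%R).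
  (* The factor at place 2 is carried over to e2 g with g in the kernel of e1, the product at place
     0 to e2 x, and the other factor is e1 x; Q then states the multiplication. Witnesses are powers
     of s2, and products of powers of s1 and s2. *)
  apply: (pos_ex_ext (P := fun e => exists g x, (e1 g = 0%R /\ e1 (e 2%N) = e2 g) /\
    (e1 x = e1 (e 1%N) /\ e1 (e 0%N) = e2 x) /\ Q (fun i => if i is 0%N then g else x))).
    move=> e; split=> [[g [x [[g0 Eg] [[Ex E] /HQ Hx]]]]|/= E].
      by have := Hx g0; rewrite /D /= E Eg -Ex.
    exists (expz s2 (e1 (e 2%N))), (expz s1 (e1 (e 1%N)) * expz s2 (e1 (e 0%N))).
    have Ez1 x t : e1 (expz x t) = (t * e1 x)%R by exact: expsum_expz.
    have Ez2 x t : e2 (expz x t) = (t * e2 x)%R by exact: expsum_expz.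
    have g0 : e1 (expz s2 (e1 (e 2%N))) = 0%R by rewrite Ez1 e12; lia.
    rewrite HQ // /D /= !e1M !e2M !Ez1 !Ez2 e11 e12 e21 e22 E.
    by split; [split | split; [split |]]; lia.
  (* From here on x sits at place 0, g at place 1 and the former place i at i + 2. *)
  apply: pos_ex_ex; apply: pos_ex_ex.
  have dren P r : gdef c P -> gdef c (fun e => P (fun i => e (r i))).
    exact: pos_ex_rename.
  apply: (pos_ex_and and_ rn).
    apply: (pos_ex_and and_ rn).
      exact: (dren (fun e => e1 (e 0%N) = 0%R) (fun=> 1%N) (zdeff_const e1M e11 i0E dR1 0)).
    exact: (dren _ (fun i => if i is 0%N then 4%N else 1%N) dR12).
  apply: (pos_ex_and and_ rn).
    apply: (pos_ex_and and_ rn).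
      exact: (dren (fun e => e1 (e 0%N) = e1 (e 1%N)) (fun i => if i is 0%N then 0%N else 3%N) dR1).
    exact: (dren _ (fun i => if i is 0%N then 2%N else 0%N) dR12).
  apply: (pos_ex_ext _ (dren Q (fun i => if i is 0%N then 1%N else 0%N) dQ)) => e.
  by rewrite (_ : (fun i => e _) = fun i => if i is 0%N then e 1%N else e 0%N) //;
    apply/funext => -[].
exact: (dp_undecidable e1M e11 i0E dR1 dmul).
Qed.
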